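(* Let $a=d=\tfrac14$ and $b=e=0$. Then $\mathcal L=\mathcal L_{a,b,d,e}$ is a real Lie algebra of dimension $9$ with basis \begin{align*} v_1&=2tx\,\partial_x+2ty\,\partial_y+t^2\partial_t+\big(2(x+y)-\tfrac t2\big)u\,\partial_u, & v_2&=x\,\partial_x+y\,\partial_y+t\,\partial_t, & v_3&=\partial_t,\\ v_4&=\sqrt{x}\sqrt{y}\,\partial_x-\sqrt{x}\sqrt{y}\,\partial_y, & v_5&=t\sqrt x\,\partial_x+2\sqrt x\,u\,\partial_u, & v_6&=\sqrt x\,\partial_x,\\ v_7&=t\sqrt y\,\partial_y+2\sqrt y\,u\,\partial_u, & v_8&=\sqrt y\,\partial_y, & v_9&=u\,\partial_u . \end{align*} The span $J$ of $v_4,\dots,v_9$ is a $6$-dimensional ideal of $\mathcal L$. The linear map sending the classes $\bar v_1\mapsto E$, $\bar v_2\mapsto \tfrac12H$, $\bar v_3\mapsto -F$ is an isomorphism of Lie algebras $\mathcal L/J\cong\mathfrak{sl}_2$, and $\mathcal L\cong\mathfrak{sl}_2\ltimes J$ (semidirect product with ideal $J$).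
   Context: All Lie algebras are real. For real constants $a,b,d,e$ consider the PDE $$\Delta:=(a-bx)u_x+(d-ey)u_y+\tfrac x2u_{xx}+\tfrac y2u_{yy}+u_t=0$$ for $u=u(x,y,t)$, $x,y>0$, $t\in\mathbb R$. An infinitesimal symmetry of the PDE is a smooth vector field $v=\xi\partial_x+\gamma\partial_y+\tau\partial_t+\phi\partial_u$ on $\{(x,y,t,u):x>0,y>0,t\in\mathbb R,u\in\mathbb R\}$, with $\xi,\gamma,\tau,\phi$ functions of $(x,y,t,u)$, whose second prolongation $\mathrm{pr}^{(2)}v$ satisfies $\mathrm{pr}^{(2)}v(\Delta)=0$ at all points of the second jet space where $\Delta=0$. $\mathcal V_{a,b,d,e}$ is the Lie algebra of all infinitesimal symmetries, under the Lie bracket of vector fields. For every $v\in\mathcal V_{a,b,d,e}$ the coefficient $\phi$ is affine in $u$: $\phi=\lambda_v(x,y,t)u+\mu_v(x,y,t)$. Set $\mathcal L_{a,b,d,e}=\{v\in\mathcal V_{a,b,d,e}:\mu_v=0\}$. $\{E,F,H\}$ is the canonical basis of $\mathfrak{sl}_2$: $[E,F]=H$, $[H,E]=2E$, $[H,F]=-2F$.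
   Formalization: In v_1 the coefficient of u∂_u is taken as 2(x+y) − t instead of the printed 2(x+y) − t/2; with t/2 the field v_1 is not an infinitesimal symmetry (pr^(2)v_1(Δ) = u/2 on Δ = 0). *)

(* Defs.v *)
From HB Require Import structures.
From mathcomp Require Import all_boot all_order all_algebra.
From mathcomp Require Import generic_quotient.
From mathcomp Require Import all_classical all_reals all_analysis.

Set Implicit Arguments.
Unset Strict Implicit.
Unset Printing Implicit Defensive.

Import Order.TTheory GRing.Theory Num.Theory.
Import numFieldNormedType.Exports.

Local Open Scope classical_set_scope.
Local Open Scope quotient_scope.
Local Open Scope ring_scope.

Ltac abel0 :=
  rewrite -[LHS]addr0 -?addrA;
  repeat match goal with
  | |- 0 = 0 => reflexivity
  | |- 0 + _ = _ => rewrite add0r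
  | |- - ?x + ?s = _ => rewrite ?(addrCA _ x) ?addKr ?addNKr
  | |- ?x + ?s = _ => rewrite ?(addrCA _ (- x)) ?addKr ?addNKr
  end.

HB.mixin Record Lmodule_isLie (R : pzRingType) V of GRing.Lmodule R V := {
  lbr : V -> V -> V;
  lbr_linearl : forall a x y z, lbr (a *: x + y) z = a *: lbr x z + lbr y z;
  lbr_linearr : forall a x y z, lbr z (a *: x + y) = a *: lbr z x + lbr z y;
  lbrr : forall x, lbr x x = 0;
  lbr_jacobi : forall x y z,
    lbr x (lbr y z) + lbr y (lbr z x) + lbr z (lbr x y) = 0
}.

#[short(type="lieAlgType")]
HB.structure Definition LieAlg (R : pzRingType) :=
  {V of Lmodule_isLie R V & GRing.Lmodule R V}.

Section LieTheory.
Variables (R : pzRingType) (g : lieAlgType R).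
Implicit Types x y z : g.

Lemma lbr0l z : lbr 0 z = 0.
Proof.
have := lbr_linearl 1 0 0 z; rewrite !scale1r addr0 => /eqP.
by rewrite -subr_eq subrr eq_sym => /eqP.
Qed.

Lemma lbr0r z : lbr z 0 = 0.
Proof.
have := lbr_linearr 1 0 0 z; rewrite !scale1r addr0 => /eqP.
by rewrite -subr_eq subrr eq_sym => /eqP.
Qed.

Lemma lbrDl x y z : lbr (x + y) z = lbr x z + lbr y z.
Proof. by rewrite -[x]scale1r lbr_linearl !scale1r. Qed.

Lemma lbrDr x y z : lbr z (x + y) = lbr z x + lbr z y.
Proof. by rewrite -[x]scale1r lbr_linearr !scale1r. Qed.

Lemma lbrC x y : lbr x y = - lbr y x.
Proof.
apply/eqP; rewrite -addr_eq0; have := lbrr (x + y).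
by rewrite lbrDl !lbrDr !lbrr add0r addr0 => ->.
Qed.

Lemma lbrNl x y : lbr (- x) y = - lbr x y.
Proof. by apply/eqP; rewrite -addr_eq0 -lbrDl addNr lbr0l. Qed.

Lemma lbrNr x y : lbr x (- y) = - lbr x y.
Proof. by apply/eqP; rewrite -addr_eq0 -lbrDr addNr lbr0r. Qed.

End LieTheory.

Record lie_iso (R : pzRingType) (g h : lieAlgType R) (f : g -> h) : Prop := {
  lie_iso_linear : linear f;
  lie_iso_bij : bijective f;
  lie_iso_br : {morph f : x y / lbr x y >-> lbr x y}
}.

Definition lspan (R : pzRingType) (V : lmodType R) n (b : 'I_n -> V) : set V :=
  [set x | exists c : 'I_n -> R, x = \sum_(i < n) c i *: b i].

Definition lin_indep (R : pzRingType) (V : lmodType R) n (b : 'I_n -> V) :=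
  forall c : 'I_n -> R, \sum_(i < n) c i *: b i = 0 -> forall i, c i = 0.

Definition is_basis (R : pzRingType) (V : lmodType R) n (b : 'I_n -> V) :=
  lin_indep b /\ lspan b = setT.

Definition has_dim (R : pzRingType) (n : nat) (V : lmodType R) :=
  exists b : 'I_n -> V, is_basis b.

(* [S] is a linear subspace of [A], stable under [br], on which [br] is a Lie
   bracket.  [br] is not required to be a Lie bracket on the whole of [A]. *)
Record lie_on (R : pzRingType) (A : lmodType R) (br : A -> A -> A)
    (S : set A) : Prop := {
  lie_on0 : S 0;
  lie_on_lin : forall a x y, S x -> S y -> S (a *: x + y);
  lie_on_br : forall x y, S x -> S y -> S (br x y);
  lie_on_linearl : forall a x y z, S x -> S y -> S z ->
    br (a *: x + y) z = a *: br x z + br y z;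
  lie_on_linearr : forall a x y z, S x -> S y -> S z ->
    br z (a *: x + y) = a *: br z x + br z y;
  lie_on_rr : forall x, S x -> br x x = 0;
  lie_on_jacobi : forall x y z, S x -> S y -> S z ->
    br x (br y z) + br y (br z x) + br z (br x y) = 0
}.

Definition lieSub (R : pzRingType) (A : lmodType R) (br : A -> A -> A)
  (S : set A) (hS : lie_on br S) : Type := {x : A | x \in S}.

Section LieSub.
Variables (R : pzRingType) (A : lmodType R) (br : A -> A -> A) (S : set A).
Variable hS : lie_on br S.

HB.instance Definition _ := SubChoice.on (lieSub hS).

Lemma lieSub_closed : submod_closed (mem S).
Proof.
split=> [|a x y]; first exact: (mem_set (lie_on0 hS)).
move=> /(@set_mem A) Sx /(@set_mem A) Sy.
exact: (mem_set (lie_on_lin hS a Sx Sy)).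
Qed.

HB.instance Definition _ :=
  GRing.SubChoice_isSubLmodule.Build R A (mem S) (lieSub hS) lieSub_closed.

Implicit Types x y z : lieSub hS.

Lemma lieSubP x : S (val x). Proof. exact/set_mem/valP. Qed.

Definition lieSub_br x y : lieSub hS :=
  Sub (br (val x) (val y)) (mem_set (lie_on_br hS (lieSubP x) (lieSubP y))).

Lemma lieSub_linearl a x y z :
  lieSub_br (a *: x + y) z = a *: lieSub_br x z + lieSub_br y z.
Proof.
apply/val_inj.
exact: (lie_on_linearl hS a (lieSubP x) (lieSubP y) (lieSubP z)).
Qed.

Lemma lieSub_linearr a x y z :
  lieSub_br z (a *: x + y) = a *: lieSub_br z x + lieSub_br z y.
Proof.
apply/val_inj.
exact: (lie_on_linearr hS a (lieSubP x) (lieSubP y) (lieSubP z)).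
Qed.

Lemma lieSub_rr x : lieSub_br x x = 0.
Proof. by apply/val_inj; exact: (lie_on_rr hS (lieSubP x)). Qed.

Lemma lieSub_jacobi x y z :
  lieSub_br x (lieSub_br y z) + lieSub_br y (lieSub_br z x)
    + lieSub_br z (lieSub_br x y) = 0.
Proof.
apply/val_inj.
exact: (lie_on_jacobi hS (lieSubP x) (lieSubP y) (lieSubP z)).
Qed.

HB.instance Definition _ := Lmodule_isLie.Build R (lieSub hS)
  lieSub_linearl lieSub_linearr lieSub_rr lieSub_jacobi.

End LieSub.

Record lie_ideal (R : pzRingType) (g : lieAlgType R) (J : set g) : Prop := {
  lie_ideal0 : J 0;
  lie_ideal_lin : forall a x y, J x -> J y -> J (a *: x + y);
  lie_ideal_br : forall x y, J y -> J (lbr x y)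
}.

Section Ideal.
Variables (R : pzRingType) (g : lieAlgType R) (J : set g).
Hypothesis hJ : lie_ideal J.

Lemma lie_ideal_on : lie_on (@lbr R g) J.
Proof.
split=> *; [exact: lie_ideal0|exact: lie_ideal_lin|exact: lie_ideal_br| | | |].
- exact: lbr_linearl.
- exact: lbr_linearr.
- exact: lbrr.
- exact: lbr_jacobi.
Qed.

Definition lieIdeal : lieAlgType R := lieSub lie_ideal_on.

Lemma lie_idealD x y : J x -> J y -> J (x + y).
Proof. by move=> Jx Jy; rewrite -[x]scale1r; exact: lie_ideal_lin. Qed.

Lemma lie_idealZ a x : J x -> J (a *: x).
Proof.
by move=> Jx; rewrite -[_ *: _]addr0; exact: lie_ideal_lin (lie_ideal0 hJ).
Qed.

Lemma lie_idealN x : J x -> J (- x).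
Proof. by move=> Jx; rewrite -scaleN1r; exact: lie_idealZ. Qed.

Lemma lie_ideal_brl x y : J x -> J (lbr x y).
Proof. by move=> Jx; rewrite lbrC; exact/lie_idealN/(lie_ideal_br hJ). Qed.

Definition coset_rel (x y : g) : bool := `[< J (x - y) >].

Lemma coset_rel_refl : reflexive coset_rel.
Proof. by move=> x; apply/asboolP; rewrite subrr; exact: lie_ideal0. Qed.

Lemma coset_rel_sym : symmetric coset_rel.
Proof.
by move=> x y; apply/asboolP/asboolP => J1; rewrite -opprB; exact: lie_idealN.
Qed.

Lemma coset_rel_trans : transitive coset_rel.
Proof.
move=> y x z /asboolP Jxy /asboolP Jyz; apply/asboolP.
by have := lie_idealD Jxy Jyz; rewrite addrA subrK.
Qed.

Definition coset_equiv : equiv_rel g :=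
  EquivRel coset_rel coset_rel_refl coset_rel_sym coset_rel_trans.

Definition lieQuot : Type := {eq_quot coset_equiv}.

HB.instance Definition _ := Choice.on lieQuot.

Definition lie_pi (x : g) : lieQuot := \pi_({eq_quot coset_equiv}) x.

Let rep (q : lieQuot) : g := repr (q : {eq_quot coset_equiv}).

Let repK q : lie_pi (rep q) = q. Proof. exact: reprK. Qed.

Lemma lie_piP x y : lie_pi x = lie_pi y <-> J (x - y).
Proof.
rewrite /lie_pi; split=> [/eqmodP /asboolP //|Jxy].
by apply/eqmodP/asboolP.
Qed.

Let rep_piP x : J (rep (lie_pi x) - x).
Proof. by apply/lie_piP; rewrite repK. Qed.

Definition quot_zero := lie_pi 0.
Definition quot_add p q := lie_pi (rep p + rep q).
Definition quot_opp q := lie_pi (- rep q).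
Definition quot_scale (a : R) q := lie_pi (a *: rep q).
Definition quot_br p q := lie_pi (lbr (rep p) (rep q)).

Lemma quot_addE x y : quot_add (lie_pi x) (lie_pi y) = lie_pi (x + y).
Proof.
apply/lie_piP; rewrite opprD addrACA.
exact: lie_idealD (rep_piP _) (rep_piP _).
Qed.

Lemma quot_oppE x : quot_opp (lie_pi x) = lie_pi (- x).
Proof. by apply/lie_piP; rewrite -opprD; exact/lie_idealN/rep_piP. Qed.

Lemma quot_scaleE a x : quot_scale a (lie_pi x) = lie_pi (a *: x).
Proof. by apply/lie_piP; rewrite -scalerBr; exact/lie_idealZ/rep_piP. Qed.

Lemma quot_brE x y : quot_br (lie_pi x) (lie_pi y) = lie_pi (lbr x y).
Proof.
apply/lie_piP; set x' := rep _; set y' := rep _.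
have -> : lbr x' y' - lbr x y = lbr (x' - x) y' + lbr x (y' - y).
  by rewrite lbrDl lbrDr lbrNl lbrNr addrA subrK.
by apply: lie_idealD; [apply: lie_ideal_brl|apply: (lie_ideal_br hJ)];
  exact: rep_piP.
Qed.

Let piE := (quot_addE, quot_oppE, quot_scaleE, quot_brE).

Lemma quot_addA : associative quot_add.
Proof.
move=> p q r; rewrite -[p]repK -[q]repK -[r]repK.
by rewrite !piE addrA.
Qed.

Lemma quot_addC : commutative quot_add.
Proof. by move=> p q; rewrite -[p]repK -[q]repK !piE addrC. Qed.

Lemma quot_add0 : left_id quot_zero quot_add.
Proof. by move=> p; rewrite -[p]repK !piE add0r. Qed.

Lemma quot_addN : left_inverse quot_zero quot_opp quot_add.
Proof. by move=> p; rewrite -[p]repK !piE addNr. Qed.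

HB.instance Definition _ := GRing.isZmodule.Build lieQuot
  quot_addA quot_addC quot_add0 quot_addN.

Lemma quot_scaleA a b q : quot_scale a (quot_scale b q) = quot_scale (a * b) q.
Proof. by rewrite -[q]repK !piE scalerA. Qed.

Lemma quot_scale1 : left_id 1 quot_scale.
Proof. by move=> q; rewrite -[q]repK !piE scale1r. Qed.

Lemma quot_scaleDr : right_distributive quot_scale +%R.
Proof.
move=> a p q; rewrite -[p]repK -[q]repK /GRing.add /=.
by rewrite !piE scalerDr.
Qed.

Lemma quot_scaleDl q : {morph quot_scale^~ q : a b / a + b}.
Proof.
move=> a b; rewrite -[q]repK [in RHS]/GRing.add /=.
by rewrite !piE scalerDl.
Qed.

HB.instance Definition _ := GRing.Zmodule_isLmodule.Build R lieQuot
  quot_scaleA quot_scale1 quot_scaleDr quot_scaleDl.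

Lemma lie_piD x y : lie_pi (x + y) = lie_pi x + lie_pi y.
Proof. by rewrite -quot_addE. Qed.

Lemma lie_piZ a x : lie_pi (a *: x) = a *: lie_pi x.
Proof. by rewrite -quot_scaleE. Qed.

Lemma quot_linearl a p q r :
  quot_br (a *: p + q) r = a *: quot_br p r + quot_br q r.
Proof.
rewrite -[p]repK -[q]repK -[r]repK -lie_piZ -lie_piD !quot_brE.
by rewrite lbr_linearl lie_piD lie_piZ.
Qed.

Lemma quot_linearr a p q r :
  quot_br r (a *: p + q) = a *: quot_br r p + quot_br r q.
Proof.
rewrite -[p]repK -[q]repK -[r]repK -lie_piZ -lie_piD !quot_brE.
by rewrite lbr_linearr lie_piD lie_piZ.
Qed.

Lemma quot_rr p : quot_br p p = 0.
Proof. by rewrite -[p]repK quot_brE lbrr. Qed.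

Lemma quot_jacobi p q r :
  quot_br p (quot_br q r) + quot_br q (quot_br r p)
    + quot_br r (quot_br p q) = 0.
Proof.
rewrite -[p]repK -[q]repK -[r]repK !quot_brE.
by rewrite -!lie_piD lbr_jacobi.
Qed.

HB.instance Definition _ := Lmodule_isLie.Build R lieQuot
  quot_linearl quot_linearr quot_rr quot_jacobi.

End Ideal.

(* [rho] is a morphism of Lie algebras from [g] to the derivations of [h]. *)
Record lie_action (R : pzRingType) (g h : lieAlgType R)
    (rho : g -> h -> h) : Prop := {
  lie_act_linear : forall x, linear (rho x);
  lie_act_linearl : forall a x y u,
    rho (a *: x + y) u = a *: rho x u + rho y u;
  lie_act_der : forall x u w,
    rho x (lbr u w) = lbr (rho x u) w + lbr u (rho x w);
  lie_act_br : forall x y u,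
    rho (lbr x y) u = rho x (rho y u) - rho y (rho x u)
}.

Definition semidirect (R : pzRingType) (g h : lieAlgType R)
  (rho : g -> h -> h) (hrho : lie_action rho) : Type := (g * h)%type.

Section Semidirect.
Variables (R : pzRingType) (g h : lieAlgType R) (rho : g -> h -> h).
Hypothesis hrho : lie_action rho.

HB.instance Definition _ := GRing.Lmodule.copy (semidirect hrho) (g * h)%type.

Definition semi_br (p q : semidirect hrho) : semidirect hrho :=
  (lbr p.1 q.1, lbr p.2 q.2 + rho p.1 q.2 - rho q.1 p.2).

Let rhoD x u w : rho x (u + w) = rho x u + rho x w.
Proof. by have := lie_act_linear hrho x 1 u w; rewrite !scale1r. Qed.

Let rhoN x u : rho x (- u) = - rho x u.
Proof.
have := lie_act_linear hrho x (-1) u u.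
rewrite !scaleN1r addNr => H; apply/eqP; rewrite -addr_eq0 -rhoD addNr.
have : rho x (0 + 0) = rho x 0 + rho x 0 by exact: rhoD.
by rewrite addr0 => /eqP; rewrite -subr_eq subrr eq_sym.
Qed.

Lemma semi_linearl a p q r :
  semi_br (a *: p + q) r = a *: semi_br p r + semi_br q r.
Proof.
case: p q r => [x u] [y v] [z w]; rewrite /semi_br /=; congr pair.
  exact: lbr_linearl.
rewrite lbr_linearl (lie_act_linearl hrho) (lie_act_linear hrho) /=.
rewrite !scalerDr scalerN !opprD !addrA; apply/eqP; rewrite -subr_eq0.
by rewrite !opprD !opprK !addrA; apply/eqP; abel0.
Qed.

Lemma semi_linearr a p q r :
  semi_br r (a *: p + q) = a *: semi_br r p + semi_br r q.
Proof.
case: p q r => [x u] [y v] [z w]; rewrite /semi_br /=; congr pair.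
  exact: lbr_linearr.
rewrite lbr_linearr (lie_act_linearl hrho) (lie_act_linear hrho) /=.
rewrite !scalerDr scalerN !opprD !addrA; apply/eqP; rewrite -subr_eq0.
by rewrite !opprD !opprK !addrA; apply/eqP; abel0.
Qed.

Lemma semi_rr p : semi_br p p = 0.
Proof. by case: p => x u; rewrite /semi_br /= !lbrr add0r subrr. Qed.

Lemma semi_jacobi p q r :
  semi_br p (semi_br q r) + semi_br q (semi_br r p)
    + semi_br r (semi_br p q) = 0.
Proof.
case: p q r => [x u] [y v] [z w]; rewrite /semi_br /=; congr pair => /=.
  exact: lbr_jacobi.
rewrite !(lie_act_br hrho) !(lbrDr, rhoD, lbrNr, rhoN) !(lie_act_der hrho).
rewrite (lbrC (rho x v)) (lbrC (rho y w)) (lbrC (rho z u)).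
rewrite -[RHS](lbr_jacobi u v w) !opprD !opprK.
apply/eqP; rewrite -subr_eq0 !opprD !addrA; apply/eqP; abel0.
Qed.

HB.instance Definition _ := Lmodule_isLie.Build R (semidirect hrho)
  semi_linearl semi_linearr semi_rr semi_jacobi.

End Semidirect.

Section Sl2.
Variable R : comPzRingType.

Definition mx_comm (A B : 'M[R]_2) : 'M[R]_2 := A *m B - B *m A.

Lemma sl2_on : lie_on mx_comm [set A | \tr A = 0].
Proof.
split=> /=.
- exact: mxtrace0.
- by move=> a x y hx hy; rewrite raddfD /= mxtraceZ hx hy mulr0 addr0.
- by move=> x y _ _; rewrite /mx_comm raddfB /= mxtrace_mulC subrr.
- move=> a x y z _ _ _; rewrite /mx_comm mulmxDl mulmxDr -scalemxAl -scalemxAr.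
  by rewrite scalerBr opprD addrACA.
- move=> a x y z _ _ _; rewrite /mx_comm mulmxDl mulmxDr -scalemxAl -scalemxAr.
  by rewrite scalerBr opprD addrACA.
- by move=> x _; rewrite /mx_comm subrr.
- move=> x y z _ _ _; rewrite /mx_comm !(mulmxBl, mulmxBr) !mulmxA.
  by rewrite !opprD !opprK; abel0.
Qed.

Definition sl2 : lieAlgType R := lieSub sl2_on.

Lemma tr_delta_off (i j : 'I_2) : i != j -> \tr (delta_mx i j : 'M[R]_2) = 0.
Proof.
move=> /negPf ij; rewrite /mxtrace big1 // => k _; rewrite mxE.
by case: eqP => //= ->; rewrite ij.
Qed.

Lemma tr_H : \tr (delta_mx 0 0 - delta_mx 1 1 : 'M[R]_2) = 0.
Proof.
by rewrite /mxtrace !big_ord_recl big_ord0 !mxE /= subr0 addr0 sub0r subrr.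
Qed.

Definition sl2E : sl2 := exist _ (delta_mx 0 1) (mem_set (@tr_delta_off 0 1 isT)).
Definition sl2F : sl2 := exist _ (delta_mx 1 0) (mem_set (@tr_delta_off 1 0 isT)).
Definition sl2H : sl2 := exist _ (delta_mx 0 0 - delta_mx 1 1) (mem_set tr_H).

End Sl2.

Lemma sl2_EF (R : comPzRingType) : lbr (sl2E R) (sl2F R) = sl2H R.
Proof.
apply/val_inj/matrixP => i j.
by rewrite /= /lieSub_br /= /mx_comm !mul_delta_mx !mxE.
Qed.

Lemma sl2_HE (R : comPzRingType) : lbr (sl2H R) (sl2E R) = 2 *: sl2E R.
Proof.
apply/val_inj; change (mx_comm (delta_mx 0 0 - delta_mx 1 1) (delta_mx 0 1)
  = 2 *: delta_mx 0 1 :> 'M[R]_2).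
rewrite /mx_comm mulmxBl mulmxBr !mul_delta_mx_cond /=.
by rewrite !mulr0n !mulr1n subr0 sub0r opprK scaler_nat mulr2n.
Qed.

Lemma sl2_HF (R : comPzRingType) : lbr (sl2H R) (sl2F R) = - 2 *: sl2F R.
Proof.
apply/val_inj; change (mx_comm (delta_mx 0 0 - delta_mx 1 1) (delta_mx 1 0)
  = - 2 *: delta_mx 1 0 :> 'M[R]_2).
rewrite /mx_comm mulmxBl mulmxBr !mul_delta_mx_cond /=.
by rewrite !mulr0n !mulr1n subr0 sub0r scaleNr scaler_nat mulr2n opprD.
Qed.

Section Smooth.
Variables (R : realType) (V W : normedModType R).

Fixpoint Cn (U : set V) (n : nat) (f : V -> W) : Prop :=
  (forall p, U p -> {for p, continuous f}) /\
  match n with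
  | 0 => True
  | n'.+1 => forall w : V,
      (forall p, U p -> derivable f p w) /\ Cn U n' (fun p => 'D_w f p)
  end.

Definition smooth_on (U : set V) (f : V -> W) := forall n, Cn U n f.

End Smooth.

(* A vector field on the open set [U] of [V] is a map [U -> V].  Its directional
   derivatives at the points of [U] are those of its extension by zero
   ['valL_0 v : V -> V], and do not depend on the values of the extension
   outside [U]. *)
Definition vf_br (R : realType) (V : normedModType R) (U : set V)
    (v w : U -> V) : U -> V :=
  fun p => 'D_(v p) ('valL_0 w) (val p) - 'D_(w p) ('valL_0 v) (val p).

(* points ((x, y, t), u) *)
Notation base R := ('rV[R]_3 * R)%type.

(* points (((x, y, t), u), (u_x, u_y, u_t), (u_ij)); the second jet space is the
   part of [jet2] where the point of [base] is in [dom] and [u_ij] is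
   symmetric *)
Notation jet1 R := (base R * 'rV[R]_3)%type.
Notation jet2 R := (jet1 R * 'M[R]_3)%type.

Section Symmetries.
Variable R : realType.

Definition ix : 'I_3 := Ordinal (isT : 0 < 3)%N.
Definition iy : 'I_3 := Ordinal (isT : 1 < 3)%N.
Definition it : 'I_3 := Ordinal (isT : 2 < 3)%N.

Definition dom : set (base R) := [set m : base R | 0 < m.1 0 ix /\ 0 < m.1 0 iy].

Definition vfield := dom -> base R.

Definition pde (a b d e : R) (j : jet2 R) : R :=
  let x := j.1.1.1 0 ix in let y := j.1.1.1 0 iy in
  let ux := j.1.2 0 ix in let uy := j.1.2 0 iy in let ut := j.1.2 0 it in
  let uxx := j.2 ix ix in let uyy := j.2 iy iy in
  (a - b * x) * ux + (d - e * y) * uy + x / 2 * uxx + y / 2 * uyy + ut.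

Definition dz (i : 'I_3) : base R := (delta_mx 0 i, 0).
Definition du : base R := (0, 1).

(* total derivatives of functions of order 0 and 1 *)
Definition totD0 (i : 'I_3) (f : base R -> R) (j : jet1 R) : R :=
  'D_(dz i) f j.1 + j.2 0 i * 'D_du f j.1.

Definition totD1 (i : 'I_3) (f : jet1 R -> R) (j : jet2 R) : R :=
  'D_((dz i, 0) : jet1 R) f j.1 + j.1.2 0 i * 'D_((du, 0) : jet1 R) f j.1
  + \sum_(k < 3) j.2 i k * 'D_((0, delta_mx 0 k) : jet1 R) f j.1.

Variable v : vfield.

Definition xi (k : 'I_3) (m : base R) : R := ('valL_0 v m).1 0 k.
Definition phi (m : base R) : R := ('valL_0 v m).2.

(* prolongation coefficients: phi^i = D_i phi - sum_k u_k D_i xi^k *)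
Definition phi1 (i : 'I_3) (j : jet1 R) : R :=
  totD0 i phi j - \sum_(k < 3) j.2 0 k * totD0 i (xi k) j.

(* phi^ij = D_j phi^i - sum_k u_ik D_j xi^k *)
Definition phi2 (i l : 'I_3) (j : jet2 R) : R :=
  totD1 l (phi1 i) j - \sum_(k < 3) j.2 i k * totD0 l (xi k) j.1.

Definition pr2 (j : jet2 R) : jet2 R :=
  (('valL_0 v j.1.1, \row_i phi1 i j.1), \matrix_(i, l) phi2 i l j).

(* the vector field [pr2 v] acts on functions on the jet space as a directional
   derivative *)
Definition is_symmetry (a b d e : R) : Prop :=
  smooth_on dom ('valL_0 v) /\
  forall j : jet2 R, dom j.1.1 -> j.2^T = j.2 ->
    pde a b d e j = 0 -> 'D_(pr2 j) (pde a b d e) j = 0.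

End Symmetries.

Arguments dom R : clear implicits.

(* the symmetries with [phi = lam(x, y, t) u + mu(x, y, t)] and [mu = 0] *)
Definition linear_symmetries (R : realType) (a b d e : R) : set (vfield R) :=
  [set v | is_symmetry v a b d e /\
    exists lam : 'rV[R]_3 -> R, forall m : dom R,
      (v m).2 = lam (val m).1 * (val m).2].

Section Generators.
Variable R : realType.

Definition vf_of (f : R -> R -> R -> R -> R * R * R * R) : vfield R :=
  fun m =>
    let z := (val m).1 in
    let: (xi, ga, ta, ph) := f (z 0 ix) (z 0 iy) (z 0 it) (val m).2 in
    (\row_i [:: xi; ga; ta]`_i, ph).

(* The coefficient of [t u] is [- 2 (a + d) = - 1].  With [- c] in its place,
   [pr2 v (pde) = (1 - c) u] on [pde = 0], so that [c = 1/2], for instance,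
   does not give a symmetry. *)
Definition vsym1 := vf_of (fun x y t u =>
  (2 * t * x, 2 * t * y, t ^+ 2, (2 * (x + y) - t) * u)).
Definition vsym2 := vf_of (fun x y t u => (x, y, t, 0)).
Definition vsym3 := vf_of (fun x y t u => (0, 0, 1, 0)).
Definition vsym4 := vf_of (fun x y t u =>
  (Num.sqrt x * Num.sqrt y, - (Num.sqrt x * Num.sqrt y), 0, 0)).
Definition vsym5 := vf_of (fun x y t u =>
  (t * Num.sqrt x, 0, 0, 2 * Num.sqrt x * u)).
Definition vsym6 := vf_of (fun x y t u => (Num.sqrt x, 0, 0, 0)).
Definition vsym7 := vf_of (fun x y t u =>
  (0, t * Num.sqrt y, 0, 2 * Num.sqrt y * u)).
Definition vsym8 := vf_of (fun x y t u => (0, Num.sqrt y, 0, 0)).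
Definition vsym9 := vf_of (fun x y t u => (0, 0, 0, u)).

Definition vsym (i : 'I_9) : vfield R :=
  nth 0 [:: vsym1; vsym2; vsym3; vsym4; vsym5; vsym6; vsym7; vsym8; vsym9] i.

End Generators.

(* Main.v *)
(* In the variables 2 sqrt x, 2 sqrt y the equation is the planar backward heat
   equation.  Comparing coefficients in the jet variables shows that tau depends
   on t only, that xi and gamma do not depend on u, and that
     x gamma_x + y xi_y = 0, xi - 2 x xi_x + x tau' = 0,
     gamma - 2 y gamma_y + y tau' = 0,
   together with three equations for lambda = phi / u.  The last two of these
   make xi / sqrt x - tau' sqrt x independent of x, and symmetrically in y, and
   the first then gives
     xi = tau' x + sqrt x (A(t) - 2 K(t) sqrt y),
     gamma = tau' y + sqrt y (B(t) + 2 K(t) sqrt x).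
   The equations for lambda read x lambda_x = xi_t, y lambda_y = gamma_t,
   lambda_t = - tau'' / 2: their compatibility forces K' = 0 and makes tau'', A'
   and B' constant, which leaves nine real constants.  Conversely the fields
   with these coefficients are the combinations of v_1, ..., v_9, and they are
   symmetries by direct computation.  In coordinates with respect to v_1, ...,
   v_9 the bracket is explicit, the first three coordinates give the projection
   to sl_2, and E -> v_1, F -> - v_3, H -> 2 v_2 - v_9 splits it. *)
Require Import Defs.
From HB Require Import structures.
From mathcomp Require Import all_boot all_order all_algebra.
From mathcomp Require Import generic_quotient.
From mathcomp Require Import all_classical all_reals all_analysis.
From mathcomp Require Import ring lra.

Set Implicit Arguments.
Unset Strict Implicit.
Unset Printing Implicit Defensive.

Import Order.TTheory GRing.Theory Num.Theory.
Import numFieldNormedType.Exports.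

Local Open Scope classical_set_scope.
Local Open Scope quotient_scope.
Local Open Scope ring_scope.

(** * Directional derivatives along lines and through continuous linear maps *)

Section DirectionalDerivatives.
Variable R : realType.

(** The difference quotients on both sides are equal for every [h], so a directional derivative is
    handled by calculus in one real variable. *)
Lemma is_derive_line (V W : normedModType R) (f : V -> W) p w l :
  is_derive p w f l <-> is_derive (0 : R) 1 (fun h : R => f (h *: w + p)) l.
Proof.
have E : 'D_w f p = 'D_1 (fun h : R => f (h *: w + p)) 0.
  rewrite /derive; set g1 := fun h => h^-1 *: _; set g2 := fun h => h^-1 *: _.
  suff -> : g1 = g2 by [].
  apply/funext => h; rewrite /g1 /g2 /=.
  by rewrite addr0 scale0r add0r [_%:A]mulr1.
split=> -[df <-].
  by apply: DeriveDef (esym E); have /derivable1P := df.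
by apply: DeriveDef E; apply/derivable1P.
Qed.

Definition clinear (V W : normedModType R) (L : V -> W) :=
  linear L /\ continuous L.

(** Linearity moves [L] through the difference quotients and continuity through their limit, so only
    the derivative along [w] enters. *)
Lemma is_derive_clinear_comp (V W W' : normedModType R) (L : W -> W')
    (f : V -> W) p w l :
  clinear L -> is_derive p w f l -> is_derive p w (L \o f) (L l).
Proof.
move=> [Ll Lc] [df <-]; have LB x y : L (x - y) = L x - L y.
  by have := Ll (-1) y x; rewrite !scaleN1r [RHS]addrC [- y + x]addrC.
have L0 : L 0 = 0 by rewrite -[0](subrr 0) LB subrr.
have LZ a x : L (a *: x) = a *: L x.
  by have := Ll a x 0; rewrite L0 !addr0.
have H : (fun h => h^-1 *: (((L \o f) \o shift p) (h *: w) - (L \o f) p)) @ 0^'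
    --> L ('D_w f p).
  rewrite [X in X @ _](_ : _ = L \o (fun h =>
    h^-1 *: ((f \o shift p) (h *: w) - f p))); last first.
    by apply/funext => h /=; rewrite LZ LB.
  by apply: continuous_cvg; [exact: Lc|exact: df].
by apply: DeriveDef; [apply/cvg_ex; exists (L ('D_w f p))|exact: cvg_lim].
Qed.

Lemma is_derive_clinear (V W : normedModType R) (L : V -> W) p w :
  clinear L -> is_derive p w L (L w).
Proof.
by move=> hL; apply: (is_derive_clinear_comp hL (is_derive_id p w)).
Qed.

Lemma is_derive_fst (V V' W : normedModType R) (f : V -> W) (q : V * V') w l :
  is_derive q.1 w.1 f l -> is_derive q w (fun q => f q.1) l.
Proof. by move=> /is_derive_line H; apply/is_derive_line. Qed.

Lemma near_open_eq (V : normedModType R) (W : Type) (U : set V) (f g : V -> W) p :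
  open U -> U p -> (forall q, U q -> f q = g q) -> \near p, f p = g p.
Proof. by move=> oU Up fg; apply: filterS (open_nbhs_nbhs (conj oU Up)). Qed.

Lemma is_derive_ext (V W : normedModType R) (U : set V) (f g : V -> W) p w l :
  open U -> (forall q, U q -> f q = g q) -> U p ->
  is_derive p w f l -> is_derive p w g l.
Proof.
by move=> oU fg Up; apply: near_eq_is_derive; exact: near_open_eq fg.
Qed.

Lemma clinear_fst (V W : normedModType R) : clinear (@fst V W).
Proof. by split=> // x; exact: cvg_fst. Qed.

Lemma clinear_snd (V W : normedModType R) : clinear (@snd V W).
Proof. by split=> // x; exact: cvg_snd. Qed.

Lemma clinear_coord m n i j : clinear (fun M : 'M[R]_(m.+1, n.+1) => M i j : R^o).
Proof. by split=> [a x y|x]; [rewrite !mxE|exact: coord_continuous]. Qed.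

Lemma clinear_comp (V W X : normedModType R) (L : V -> W) (M : W -> X) :
  clinear L -> clinear M -> clinear (M \o L).
Proof.
move=> [Ll Lc] [Ml Mc]; split=> [a x y|x] /=; first by rewrite Ll Ml.
exact: continuous_comp (Lc _) (Mc _).
Qed.

Lemma clinear_scale (V : normedModType R) (v : V) : clinear (fun r : R^o => r *: v).
Proof.
split=> [a x y|x]; first by rewrite scalerDl scalerA.
exact: scalel_continuous.
Qed.

End DirectionalDerivatives.

(** * Stability of the classes [Cn] on an open set *)

Section SmoothFunctions.
Variable R : realType.
Variables (V : normedModType R) (U : set V).
Hypothesis oU : open U.

(** Agreement on an open set is agreement near each of its points, so the derivatives agree on [U]
    as well and induction applies. This allows a derivative to be replaced by a formula valid only
    on [U]. *)
Lemma Cn_ext (W : normedModType R) n (f g : V -> W) :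
  (forall q, U q -> f q = g q) -> Cn U n f -> Cn U n g.
Proof.
elim: n f g => [|n IH] f g fg /= [cf df].
  split=> // p Up; have fgp := near_open_eq oU Up fg.
  rewrite /prop_for /continuous_at -(fg p Up).
  by apply: cvg_trans (cf p Up); apply: near_eq_cvg; apply: filterS fgp.
split.
  move=> p Up; have fgp := near_open_eq oU Up fg.
  rewrite /prop_for /continuous_at -(fg p Up).
  by apply: cvg_trans (cf p Up); apply: near_eq_cvg; apply: filterS fgp.
move=> w; have [d1 d2] := df w; split=> [p Up|].
  exact: near_eq_derivable (near_open_eq oU Up fg) (d1 p Up).
apply: IH d2 => p Up; apply: near_eq_derive.
exact: near_open_eq fg.
Qed.

Lemma CnD (W : normedModType R) n (f g : V -> W) :
  Cn U n f -> Cn U n g -> Cn U n (f + g).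
Proof.
elim: n f g => [|n IH] f g /= [cf df] [cg dg].
  by split=> // p Up; apply: continuousD; [exact: cf|exact: cg].
split=> [p Up|w]; first by apply: continuousD; [exact: cf|exact: cg].
have [d1 d2] := df w; have [e1 e2] := dg w; split=> [p Up|].
  by apply: derivableD; [exact: d1|exact: e1].
apply: Cn_ext (IH _ _ d2 e2) => p Up.
by rewrite deriveD //; [exact: d1|exact: e1].
Qed.

Lemma Cn_clinear_comp (W W' : normedModType R) (L : W -> W') n (f : V -> W) :
  clinear L -> Cn U n f -> Cn U n (L \o f).
Proof.
move=> hL; elim: n f => [|n IH] f /= [cf df].
  by split=> // p Up; apply: continuous_comp; [exact: cf|exact: hL.2].
split=> [p Up|w]; first by apply: continuous_comp; [exact: cf|exact: hL.2].
have [d1 d2] := df w; split=> [p Up|].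
  by have [] := is_derive_clinear_comp hL (derivableP (d1 p Up)).
apply: Cn_ext (IH _ d2) => p Up.
by have [_ ->] := is_derive_clinear_comp hL (derivableP (d1 p Up)).
Qed.

(* A family of functions that is stable under directional derivatives consists
   of smooth functions. *)
Lemma Cn_family (W : normedModType R) (T : Type) (ev : T -> V -> W)
    (d : V -> T -> T) :
  (forall e p, U p -> {for p, continuous (ev e)}) ->
  (forall e w p, U p -> is_derive p w (ev e) (ev (d w e) p)) ->
  forall e n, Cn U n (ev e).
Proof.
move=> cev dev e n; elim: n e => [|n IH] e; first by split=> // p; exact: cev.
split=> [p|w]; first exact: cev.
split=> [p Up|]; first by have [] := dev e w p Up.
by apply: Cn_ext (IH (d w e)) => p Up; have [_ ->] := dev e w p Up.
Qed.

Lemma Cn_derivable (W : normedModType R) n (f : V -> W) p w :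
  Cn U n.+1 f -> U p -> is_derive p w f ('D_w f p).
Proof. by move=> [_ df] Up; apply: derivableP; have [d _] := df w; exact: d. Qed.

Lemma Cn_derive (W : normedModType R) n (f : V -> W) w :
  Cn U n.+1 f -> Cn U n (fun p => 'D_w f p).
Proof. by move=> [_ df]; have [] := df w. Qed.

End SmoothFunctions.

(** * Differentiation rules for sums and products written pointwise *)

Section PointwiseRules.
Variables (R : realType) (V : normedModType R).
Implicit Types (f g : V -> R) (p w : V).

Lemma is_derive_add f g p w a b : is_derive p w f a -> is_derive p w g b ->
  is_derive p w (fun q => f q + g q) (a + b).
Proof. exact: is_deriveD. Qed.

Lemma is_derive_opp f p w a : is_derive p w f a ->
  is_derive p w (fun q => - f q) (- a).
Proof. exact: is_deriveN. Qed.

Lemma is_derive_mul f g p w a b : is_derive p w f a -> is_derive p w g b ->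
  is_derive p w (fun q => f q * g q) (f p * b + g p * a).
Proof. exact: is_deriveM. Qed.

Lemma is_derive_sum_fun n (f : 'I_n -> V -> R) p w (a : 'I_n -> R) :
  (forall i, is_derive p w (f i) (a i)) ->
  is_derive p w (fun q => \sum_(i < n) f i q) (\sum_(i < n) a i).
Proof.
move=> df; have -> : (fun q => \sum_(i < n) f i q) = \sum_(i < n) f i.
  by apply/funext => q; rewrite fct_sumE.
exact: is_derive_sum.
Qed.

End PointwiseRules.

(** * Explicit prolongation formulas and the differential of the equation *)

Section Prolongation.
Variable R : realType.
Implicit Types (v : vfield R) (m w : base R).

Lemma sum3E (V : nmodType) (F : 'I_3 -> V) :
  \sum_(k < 3) F k = F ix + F iy + F it.
Proof.
rewrite !big_ord_recl big_ord0 addr0 addrA.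
by congr (F _ + F _ + F _); apply/val_inj.
Qed.

Lemma clinear_base (k : 'I_3) : clinear (fun m : base R => m.1 0 k : R^o).
Proof. exact: (clinear_comp (@clinear_fst _ _ _) (@clinear_coord _ 0 2 0 k)). Qed.

Lemma open_dom : open (dom R).
Proof.
have H k : open [set m : base R | 0 < m.1 0 k].
  apply: (@open_comp _ _ (fun m : base R => m.1 0 k : R^o) [set r | 0 < r]).
    by move=> m _; exact: (clinear_base k).2.
  exact: open_gt.
exact: openI (H ix) (H iy).
Qed.

Lemma Cn_xi v n k : Cn (dom R) n ('valL_0 v) -> Cn (dom R) n (xi v k).
Proof. exact: (Cn_clinear_comp open_dom (clinear_base k)). Qed.

Lemma Cn_phi v n : Cn (dom R) n ('valL_0 v) -> Cn (dom R) n (phi v).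
Proof. exact: (Cn_clinear_comp open_dom (@clinear_snd _ _ _)). Qed.

Definition dd w (f : base R -> R) m : R := 'D_w f m.

(** The Kronecker symbol keeps only [l = i]. The sum of [s k * (E k + p i * F k)] arises twice, from
    differentiating [phi1] in the first-order jet variables and from the correction term of [phi2];
    hence the factor 2. *)
Lemma phi2_algebra n (i : 'I_n) (a b c d e : R) (A B C D E F p s : 'I_n -> R) :
  a + p i * b - \sum_(k < n) p k * (A k + p i * B k)
  + p i * (c + p i * d - \sum_(k < n) p k * (C k + p i * D k))
  + \sum_(l < n) s l * ((i == l)%:R * (e - \sum_(k < n) p k * F k)
                        - (E l + p i * F l))
  - \sum_(k < n) s k * (E k + p i * F k) =
  a + p i * (b + c) + p i ^+ 2 * d + s i * e
  - \sum_(k < n) p k * (A k + p i * (B k + C k) + p i ^+ 2 * D k)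
  - 2 * \sum_(k < n) s k * (E k + p i * F k)
  - s i * \sum_(k < n) p k * F k.
Proof.
have -> : \sum_(l < n) s l * ((i == l)%:R * (e - \sum_(k < n) p k * F k)
                        - (E l + p i * F l)) =
    s i * (e - \sum_(k < n) p k * F k)
    - \sum_(l < n) s l * (E l + p i * F l).
  move: (e - _) => x; under eq_bigr do rewrite mulrBr.
  rewrite big_split /= sumrN; congr (_ - _).
  rewrite (bigD1 i) //= eqxx mulr1n mul1r big1 ?addr0 // => k /negPf ki.
  by rewrite eq_sym ki mul0r mulr0.
have -> : \sum_(k < n) p k * (A k + p i * (B k + C k) + p i ^+ 2 * D k) =
   \sum_(k < n) p k * (A k + p i * B k)
   + p i * \sum_(k < n) p k * (C k + p i * D k).
  by rewrite mulr_sumr -big_split /=; apply: eq_bigr => k _; ring.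
ring.
Qed.

Section Formulas.
Variable v : vfield R.
Hypothesis sv : Cn (dom R) 2 ('valL_0 v).

Let p1 (j : jet1 R) k : R := j.2 0 k.

(** [A] is differentiation at [j.1] along the base part of [w]; it is zero when [w] points along the
    fibre. *)
Lemma is_derive_phi1 i (j w : jet1 R) (A : (base R -> R) -> R) :
  dom R j.1 -> (forall g, dd w.1 g j.1 = A g) ->
  is_derive j w (phi1 v i)
    (A (dd (dz R i) (phi v))
     + (p1 j i * A (dd (du R) (phi v)) + dd (du R) (phi v) j.1 * p1 w i)
     - \sum_(k < 3) (p1 j k *
          (A (dd (dz R i) (xi v k))
           + (p1 j i * A (dd (du R) (xi v k))
              + dd (du R) (xi v k) j.1 * p1 w i))
        + (dd (dz R i) (xi v k) j.1 + p1 j i * dd (du R) (xi v k) j.1)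
          * p1 w k)).
Proof.
move=> dj hA; rewrite /phi1 /totD0.
have dp k : is_derive j w (fun j : jet1 R => j.2 0 k : R) (p1 w k).
  apply: (is_derive_clinear j w (L := fun j : jet1 R => j.2 0 k : R^o)).
  exact: (clinear_comp (@clinear_snd _ _ _) (@clinear_coord _ 0 2 0 k)).
have d1 f e : Cn (dom R) 2 f ->
    is_derive j w (fun j : jet1 R => 'D_e f j.1 : R) (A (dd e f)).
  move=> Cf; rewrite -hA; apply: (@is_derive_fst R _ _ _ (fun m => 'D_e f m)).
  exact: Cn_derivable (Cn_derive _ Cf) dj.
have Cp := Cn_phi sv; have Cx k := Cn_xi k sv.
apply: (is_derive_add
  (is_derive_add (d1 _ _ Cp) (is_derive_mul (dp i) (d1 _ _ Cp)))).
apply: is_derive_opp; apply: is_derive_sum_fun => k.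
exact: (is_derive_mul (dp k)
  (is_derive_add (d1 _ _ (Cx k)) (is_derive_mul (dp i) (d1 _ _ (Cx k))))).
Qed.

Lemma phi1E i (j : jet1 R) :
  phi1 v i j = dd (dz R i) (phi v) j.1 + j.2 0 i * dd (du R) (phi v) j.1
    - \sum_(k < 3) j.2 0 k *
        (dd (dz R i) (xi v k) j.1 + j.2 0 i * dd (du R) (xi v k) j.1).
Proof. by []. Qed.

(** Only the diagonal coefficients are expanded, because u_xx and u_yy are the second-order
    variables of [pde]. The two orders of a mixed derivative enter through their sum. *)
Lemma phi2E i (j : jet2 R) : dom R j.1.1 ->
  let m := j.1.1 in let p k := j.1.2 0 k in let s k := j.2 i k in
  let f := phi v in let X := xi v in
  phi2 v i i j =
    dd (dz R i) (dd (dz R i) f) m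
    + p i * (dd (dz R i) (dd (du R) f) m + dd (du R) (dd (dz R i) f) m)
    + p i ^+ 2 * dd (du R) (dd (du R) f) m + s i * dd (du R) f m
    - \sum_(k < 3) (p k * (dd (dz R i) (dd (dz R i) (X k)) m
        + p i * (dd (dz R i) (dd (du R) (X k)) m
                 + dd (du R) (dd (dz R i) (X k)) m)
        + p i ^+ 2 * dd (du R) (dd (du R) (X k)) m))
    - 2 * \sum_(k < 3) s k * (dd (dz R i) (X k) m + p i * dd (du R) (X k) m)
    - s i * \sum_(k < 3) p k * dd (du R) (X k) m.
Proof.
move=> dj m p s f X.
(* The three kinds of derivative in [totD1]: along a base coordinate, along u, and along a
   first-order jet variable. *)
have E1 : 'D_((dz R i, 0) : jet1 R) (phi1 v i) j.1 =
    dd (dz R i) (dd (dz R i) f) m + p i * dd (dz R i) (dd (du R) f) m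
    - \sum_(k < 3) p k * (dd (dz R i) (dd (dz R i) (X k)) m
                     + p i * dd (dz R i) (dd (du R) (X k)) m).
  have [_ ->] := is_derive_phi1 (j := j.1) (w := ((dz R i, 0) : jet1 R)) i
    (A := fun g => dd (dz R i) g m) dj (fun=> erefl).
  rewrite /p1 /=; congr (_ + _ - _); first by rewrite mxE mulr0 addr0.
  by apply: eq_bigr => k _; rewrite !mxE !mulr0 !addr0.
have E2 : 'D_((du R, 0) : jet1 R) (phi1 v i) j.1 =
    dd (du R) (dd (dz R i) f) m + p i * dd (du R) (dd (du R) f) m
    - \sum_(k < 3) p k * (dd (du R) (dd (dz R i) (X k)) m
                     + p i * dd (du R) (dd (du R) (X k)) m).
  have [_ ->] := is_derive_phi1 (j := j.1) (w := ((du R, 0) : jet1 R)) i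
    (A := fun g => dd (du R) g m) dj (fun=> erefl).
  rewrite /p1 /=; congr (_ + _ - _); first by rewrite mxE mulr0 addr0.
  by apply: eq_bigr => k _; rewrite !mxE !mulr0 !addr0.
have E3 l : 'D_((0, delta_mx 0 l) : jet1 R) (phi1 v i) j.1 =
    (i == l)%:R * (dd (du R) f m - \sum_(k < 3) p k * dd (du R) (X k) m)
    - (dd (dz R i) (X l) m + p i * dd (du R) (X l) m).
  have D0 (g : base R -> R) : dd 0 g m = 0 by exact: derive0.
  have [_ ->] := is_derive_phi1 (j := j.1) (w := ((0, delta_mx 0 l) : jet1 R)) i
    (A := fun g => 0) dj D0.
  rewrite /p1 mxE /= big_split /=.
  rewrite [X in _ - (_ + X)](bigD1 l) //= [X in _ - (_ + (_ + X))]big1; last first.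
    by move=> k /negPf kl; rewrite mxE eqxx /= kl mulr0.
  rewrite [X in _ - (X + _)](_ : _ =
      (i == l)%:R * \sum_(k < 3) p k * dd (du R) (X k) m); last first.
    rewrite mulr_sumr; apply: eq_bigr => k _; rewrite -/(p k) -/(X k) -/m.
    move: (dd (du R) (X k) m) (p k) => a b.
    by ring.
  rewrite mxE !eqxx -/f -/(X l) -/m -/(p i) andTb.
  move: (dd (du R) f m) (dd (du R) (X l) m) (dd (dz R i) (X l) m) (p i).
  move: (\sum_(k < 3) _) => a b c d q.
  by rewrite /= mulr1n; ring.
transitivity (
    dd (dz R i) (dd (dz R i) f) m + p i * dd (dz R i) (dd (du R) f) m
    - \sum_(k < 3) p k * (dd (dz R i) (dd (dz R i) (X k)) m
                     + p i * dd (dz R i) (dd (du R) (X k)) m)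
    + p i * (dd (du R) (dd (dz R i) f) m + p i * dd (du R) (dd (du R) f) m
    - \sum_(k < 3) p k * (dd (du R) (dd (dz R i) (X k)) m
                     + p i * dd (du R) (dd (du R) (X k)) m))
    + \sum_(l < 3) s l * (
    (i == l)%:R * (dd (du R) f m - \sum_(k < 3) p k * dd (du R) (X k) m)
    - (dd (dz R i) (X l) m + p i * dd (du R) (X l) m))
    - \sum_(k < 3) s k * (dd (dz R i) (X k) m + p i * dd (du R) (X k) m)).
  congr (_ + _ - _); first by congr (_ + _); [exact: E1|congr (_ * _); exact: E2].
  by apply: eq_bigr => l _; congr (_ * _); exact: E3.
exact: (phi2_algebra i _ _ _ _ _ (fun k => _) (fun k => _) (fun k => _)
  (fun k => _) (fun k => _) (fun k => _)).
Qed.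

End Formulas.
Lemma is_derive_pde a b d e (j w : jet2 R) :
  is_derive j w (pde a b d e)
    ((a - b * j.1.1.1 0 ix) * w.1.2 0 ix - b * w.1.1.1 0 ix * j.1.2 0 ix
     + ((d - e * j.1.1.1 0 iy) * w.1.2 0 iy - e * w.1.1.1 0 iy * j.1.2 0 iy)
     + (j.1.1.1 0 ix / 2 * w.2 ix ix + w.1.1.1 0 ix / 2 * j.2 ix ix)
     + (j.1.1.1 0 iy / 2 * w.2 iy iy + w.1.1.1 0 iy / 2 * j.2 iy iy)
     + w.1.2 0 it).
Proof.
have dx k : is_derive j w (fun j : jet2 R => j.1.1.1 0 k : R) (w.1.1.1 0 k).
  apply: (is_derive_clinear j w (L := fun j : jet2 R => j.1.1.1 0 k : R^o)).
  exact: (clinear_comp (clinear_comp (@clinear_fst _ _ _) (@clinear_fst _ _ _))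
    (clinear_base k)).
have dp k : is_derive j w (fun j : jet2 R => j.1.2 0 k : R) (w.1.2 0 k).
  apply: (is_derive_clinear j w (L := fun j : jet2 R => j.1.2 0 k : R^o)).
  exact: (clinear_comp (clinear_comp (@clinear_fst _ _ _) (@clinear_snd _ _ _))
    (@clinear_coord _ 0 2 0 k)).
have ds k l : is_derive j w (fun j : jet2 R => j.2 k l : R) (w.2 k l).
  apply: (is_derive_clinear j w (L := fun j : jet2 R => j.2 k l : R^o)).
  exact: (clinear_comp (@clinear_snd _ _ _) (@clinear_coord _ 2 2 k l)).
have dc (c : R) : is_derive j w (fun=> c) 0 by exact: is_derive_cst.
have H1 a b k := is_derive_mul (is_derive_add (dc a)
  (is_derive_opp (is_derive_mul (dc b) (dx k)))) (dp k).
have H2 k := is_derive_mul (is_derive_mul (dx k) (dc 2^-1)) (ds k k).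
apply: is_derive_eq (is_derive_add (is_derive_add (is_derive_add
  (is_derive_add (H1 a b ix) (H1 d e iy)) (H2 ix)) (H2 iy)) (dp it)) _.
ring.
Qed.

End Prolongation.

(** * The determining equations at one point *)

Section DeterminingEquations.
Variable R : realType.
Implicit Types (v : vfield R).

Lemma pr2_pdeE v (j : jet2 R) :
  'D_(pr2 v j) (pde (1 / 4) 0 (1 / 4) 0) j =
    1 / 4 * phi1 v ix j.1 + 1 / 4 * phi1 v iy j.1
    + (j.1.1.1 0 ix / 2 * phi2 v ix ix j + xi v ix j.1.1 / 2 * j.2 ix ix)
    + (j.1.1.1 0 iy / 2 * phi2 v iy iy j + xi v iy j.1.1 / 2 * j.2 iy iy)
    + phi1 v it j.1.
Proof.
have [_ ->] := is_derive_pde (1 / 4) 0 (1 / 4) 0 j (pr2 v j).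
rewrite /= !mxE -/(xi v ix j.1.1) -/(xi v iy j.1.1).
by rewrite !mul0r !subr0.
Qed.

(* The variables stand for the coordinates and the derivatives at one point:
   [Xx] for xi_x, [F1] for phi_xu + phi_ux, and so on. *)
Section OnePoint.
Variables (x y X Y : R).
Variables (fx fy ft fu fxx F1 fyy F2 fuu : R).
Variables (Xx Xy Xt Xu Xxx X1 Xyy X2 Xuu : R).
Variables (Yx Yy Yt Yu Yxx Y1 Yyy Y2 Yuu : R).
Variables (Tx Ty Tt Tu Txx T1 Tyy T2 Tuu : R).

Definition prol1 (p q r : R) z fz fu Xz Xu Yz Yu Tz Tu : R :=
  fz + z * fu
  - (p * (Xz + z * Xu) + q * (Yz + z * Yu) + r * (Tz + z * Tu)).

Definition prol2 (p q r : R) z s s1 s2 s3 fzz Fz fuu fu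
    Xzz XZ Xuu Xz Xu Yzz YZ Yuu Yz Yu Tzz TZ Tuu Tz Tu : R :=
  fzz + z * Fz + z ^+ 2 * fuu + s * fu
  - (p * (Xzz + z * XZ + z ^+ 2 * Xuu) + q * (Yzz + z * YZ + z ^+ 2 * Yuu)
     + r * (Tzz + z * TZ + z ^+ 2 * Tuu))
  - 2 * (s1 * (Xz + z * Xu) + s2 * (Yz + z * Yu) + s3 * (Tz + z * Tu))
  - s * (p * Xu + q * Yu + r * Tu).

(** The derivative of the equation along the prolonged field, as a polynomial in the jet variables:
    [p q r] are u_x, u_y, u_t and [a b c d e] are u_xx, u_xy, u_yy, u_xt, u_yt. *)
Definition symbol (p q r a b c d e : R) : R :=
  1 / 4 * prol1 p q r p fx fu Xx Xu Yx Yu Tx Tu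
  + 1 / 4 * prol1 p q r q fy fu Xy Xu Yy Yu Ty Tu
  + (x / 2 * prol2 p q r p a a b d fxx F1 fuu fu
       Xxx X1 Xuu Xx Xu Yxx Y1 Yuu Yx Yu Txx T1 Tuu Tx Tu + X / 2 * a)
  + (y / 2 * prol2 p q r q c b c e fyy F2 fuu fu
       Xyy X2 Xuu Xy Xu Yyy Y2 Yuu Yy Yu Tyy T2 Tuu Ty Tu + Y / 2 * c)
  + prol1 p q r r ft fu Xt Xu Yt Yu Tt Tu.

Hypotheses (x0 : 0 < x) (y0 : 0 < y).
Hypothesis sym : forall p q r a b c d e,
  1 / 4 * p + 1 / 4 * q + x / 2 * a + y / 2 * c + r = 0 ->
  symbol p q r a b c d e = 0.

(** On solutions u_t is determined by the other jet variables, which remain free. *)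
Let ev p q a b c d e := @sym p q
  (- (1 / 4 * p + 1 / 4 * q + x / 2 * a + y / 2 * c)) a b c d e (subrr _).

(** Differences of values at sample jets isolate single coefficients. Up to sign, u_xt yields x T_x,
    u_yt yields y T_y, u_x u_xt yields x T_u, u_x u_xy and u_y u_xy yield x Y_u and y X_u, and u_xy
    yields the last relation. *)
Lemma sym_first_order :
  [/\ Tx = 0, Ty = 0, Tu = 0 & [/\ Xu = 0, Yu = 0 & x * Yx + y * Xy = 0]].
Proof.
have E0 := ev 0 0 0 0 0 0 0.
have Ed := ev 0 0 0 0 0 1 0.
have Ee := ev 0 0 0 0 0 0 1.
have P0 := ev 1 0 0 0 0 0 0.
have Pd := ev 1 0 0 0 0 1 0.
have Pb := ev 1 0 0 1 0 0 0.
have Q0 := ev 0 1 0 0 0 0 0.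
have Qb := ev 0 1 0 1 0 0 0.
have Eb := ev 0 0 0 1 0 0 0.
rewrite /symbol /prol1 /prol2 in E0 Ed Ee P0 Pd Pb Q0 Qb Eb.
have xn : x != 0 by rewrite gt_eqF.
have yn : y != 0 by rewrite gt_eqF.
have z0 (a b : R) : a != 0 -> a * b = 0 -> b = 0.
  by move=> /negPf a0 /eqP; rewrite mulf_eq0 a0 => /eqP.
have hTx : Tx = 0 by apply: (z0 x) => //; lra.
have hTy : Ty = 0 by apply: (z0 y) => //; lra.
have hTu : Tu = 0 by apply: (z0 x) => //; lra.
have hYu : Yu = 0 by apply: (z0 x) => //; lra.
have hXu : Xu = 0 by apply: (z0 y) => //; lra.
by split=> //; split=> //; lra.
Qed.

Hypotheses (hTxx : Txx = 0) (hTyy : Tyy = 0).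

(** The conclusions are, in order, the coefficients of u_xx, u_yy, u_x, u_y and the constant term,
    up to constant factors. *)
Lemma sym_second_order :
  [/\ X - 2 * x * Xx + x * Tt = 0, Y - 2 * y * Yy + y * Tt = 0,
    - Xx / 4 - Xy / 4 + x / 2 * (F1 - Xxx) - y / 2 * Xyy - Xt + Tt / 4 = 0,
    - Yx / 4 - Yy / 4 - x / 2 * Yxx + y / 2 * (F2 - Yyy) - Yt + Tt / 4 = 0
    & (fx + fy) / 4 + x / 2 * fxx + y / 2 * fyy + ft = 0].
Proof.
have [hTx hTy hTu [hXu hYu hXY]] := sym_first_order.
have E0 := ev 0 0 0 0 0 0 0.
have Ea := ev 0 0 1 0 0 0 0.
have Ec := ev 0 0 0 0 1 0 0.
(* With u_t eliminated the value is a cubic polynomial in u_x, whose linear coefficient is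
   determined by the values at 0, 1, -1, 2, -2. The same holds for u_y. *)
have P1 := ev 1 0 0 0 0 0 0.
have P2 := ev (-1) 0 0 0 0 0 0.
have P3 := ev 2 0 0 0 0 0 0.
have P4 := ev (-2) 0 0 0 0 0 0.
have Q1 := ev 0 1 0 0 0 0 0.
have Q2 := ev 0 (-1) 0 0 0 0 0.
have Q3 := ev 0 2 0 0 0 0 0.
have Q4 := ev 0 (-2) 0 0 0 0 0.
rewrite /symbol /prol1 /prol2 hTx hTy hTu hXu hYu hTxx hTyy
  in E0 Ea Ec P1 P2 P3 P4 Q1 Q2 Q3 Q4.
by split; [clear P1 P2 P3 P4 Q1 Q2 Q3 Q4|clear P1 P2 P3 P4 Q1 Q2 Q3 Q4
  |clear Q1 Q2 Q3 Q4|clear P1 P2 P3 P4|clear P1 P2 P3 P4 Q1 Q2 Q3 Q4]; lra.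
Qed.

End OnePoint.
End DeterminingEquations.

(** * One-variable calculus on the line and on the positive half-line *)

Section OneVariable.
Variable R : realType.
Implicit Types (f g : R -> R) (a b x y : R).

Lemma is_derive_unique f a b x :
  is_derive x 1 f a -> is_derive x 1 f b -> a = b.
Proof. by move=> [_ <-] [_ <-]. Qed.

(** The half-line is open, so an identity valid only there still fixes the derivatives at its
    points. *)
Lemma is_derive_unique_pos f g a b x : 0 < x -> (forall z, 0 < z -> f z = g z) ->
  is_derive x 1 f a -> is_derive x 1 g b -> a = b.
Proof.
move=> x0 fg fa; apply: is_derive_unique.
have oU : open [set z : R | 0 < z] by exact: open_gt.
exact: (@is_derive_ext R _ _ _ f g _ _ _ oU fg x0 fa).
Qed.

Lemma eq_increment f g (f' : R -> R) :
  (forall x, is_derive x 1 f (f' x)) -> (forall x, is_derive x 1 g (f' x)) ->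
  forall x y, f x - g x = f y - g y.
Proof.
move=> df dg x y; apply: (is_derive_0_is_cst (f := fun x => f x - g x)) => z.
by rewrite -(subrr (f' z)); exact: is_derive_add (df z) (is_derive_opp (dg z)).
Qed.

(** The mean value theorem is applied on a segment contained in the half-line. *)
Lemma is_derive_0_is_cst_pos f :
  (forall x : R, 0 < x -> is_derive x 1 f 0) ->
  forall x y, 0 < x -> 0 < y -> f x = f y.
Proof.
move=> df; suff H (x y : R) : 0 < x -> x <= y -> f y - f x = 0.
  move=> x y x0 y0; case: (leP x y) => [xy|/ltW yx].
    by apply/esym/subr0_eq; exact: H xy.
  by apply/subr0_eq; exact: H yx.
move=> x0 xy; have [||c _ ->] := MVT_segment (f := f) (df := fun=> 0) xy.
- move=> z; rewrite in_itv /= => /andP[xz _]; apply: df; exact: lt_trans xz.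
- apply: derivable_within_continuous => z; rewrite in_itv /= => /andP[xz _].
  by have [] := df z (lt_le_trans x0 xz).
- by rewrite mul0r.
Qed.

Lemma eq_increment_pos f g (f' : R -> R) :
  (forall x, 0 < x -> is_derive x 1 f (f' x)) ->
  (forall x, 0 < x -> is_derive x 1 g (f' x)) ->
  forall x y, 0 < x -> 0 < y -> f x - g x = f y - g y.
Proof.
move=> df dg; apply: (is_derive_0_is_cst_pos (f := fun x => f x - g x)) => z z0.
rewrite -(subrr (f' z)).
exact: is_derive_add (df z z0) (is_derive_opp (dg z z0)).
Qed.

Lemma is_derive_sqrt x : 0 < x ->
  is_derive x 1 (fun z : R => Num.sqrt z) (2 * Num.sqrt x)^-1.
Proof. exact: is_derive1_sqrt. Qed.

Lemma is_derive_inv_sqrt x : 0 < x ->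
  is_derive x 1 (fun z : R => (Num.sqrt z)^-1) (- (2 * x * Num.sqrt x)^-1).
Proof.
move=> x0; have s0 : 0 < Num.sqrt x by rewrite sqrtr_gt0.
have sn := lt0r_neq0 s0.
apply: is_derive_eq (is_deriveV sn (is_derive_sqrt x0)) _.
have := sqr_sqrtr (ltW x0); move: (Num.sqrt x) sn => s sn <-.
rewrite scaleNr; congr (- _); rewrite -[_ *: _]/(_ * _).
by field.
Qed.

End OneVariable.

(** * Ordinary differential equations solved by square roots *)

Section SolvingTheEquations.
Variable R : realType.
Local Notation sqrt := (@Num.sqrt R).

Lemma sqrt_gt0_neq0 (x : R) : 0 < x -> sqrt x != 0.
Proof. by move=> x0; rewrite lt0r_neq0 // sqrtr_gt0. Qed.

Lemma is_derive_cstl (c : R) (f : R -> R) (x a : R) :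
  is_derive x 1 f a -> is_derive x 1 (fun z => c * f z) (c * a).
Proof.
move=> df; apply: is_derive_eq (is_derive_mul (is_derive_cst c x 1) df) _.
by rewrite mulr0 addr0.
Qed.

Lemma is_derive_idfun (x : R) : is_derive x 1 (fun z : R => z) 1.
Proof. exact: is_derive_id. Qed.

Lemma is_derive_eval (f : R -> R) (x a b : R) :
  is_derive x 1 f a -> a = b -> is_derive x 1 f b.
Proof. by move=> df <-. Qed.

Section OdeSqrt.
Variables (f f1 : R -> R) (c : R).
Hypothesis df : forall x : R, 0 < x -> is_derive x 1 f (f1 x).
Hypothesis ode : forall x : R, 0 < x -> f x - 2 * x * f1 x + x * c = 0.

(** The equation says that f / sqrt x - c sqrt x has derivative zero; its constant value is read off
    at 1. *)
Lemma ode_sqrt (x : R) : 0 < x -> f x = sqrt x * (c * sqrt x + f 1 - c).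
Proof.
move=> x0.
have H : f x * (sqrt x)^-1 - c * sqrt x = f 1 * (sqrt 1)^-1 - c * sqrt 1.
  apply: (eq_increment_pos (f := fun x => f x * (sqrt x)^-1)
    (g := fun x => c * sqrt x) (f' := fun x => c * (2 * sqrt x)^-1)) ltr01 => //
    z z0; last exact: is_derive_cstl (is_derive_sqrt z0).
  have sz := sqrt_gt0_neq0 z0.
  apply: is_derive_eval (is_derive_mul (df z0) (is_derive_inv_sqrt z0)) _.
  have := ode z0; have := sqr_sqrtr (ltW z0).
  move: (sqrt z) sz => s sz zE e.
  have -> : f z = 2 * z * f1 z - z * c by lra.
  by rewrite -zE; field.
rewrite sqrtr1 invr1 !mulr1 in H; have sx := sqrt_gt0_neq0 x0.
have -> : f x = sqrt x * (f x * (sqrt x)^-1) by field.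
by congr (_ * _); lra.
Qed.

(** The operator f'/4 + x f''/2 is the x-part of the equation. It annihilates sqrt x and sends x to
    1/4, while f is c x plus a multiple of sqrt x. *)
Lemma ode_sqrt_heat (x a : R) : 0 < x -> is_derive x 1 f1 a ->
  f1 x / 4 + x / 2 * a = c / 4.
Proof.
move=> x0 da.
have f1E (z : R) : 0 < z -> f1 z = 2^-1 * (f z * z^-1) + 2^-1 * c.
  move=> z0; have zn := lt0r_neq0 z0.
  have -> : f z = 2 * z * f1 z - z * c by have := ode z0; lra.
  by field.
have xn := lt0r_neq0 x0.
have dV : is_derive x 1 (fun z : R => z^-1) (- x ^- 2).
  apply: is_derive_eval (is_deriveV xn (is_derive_idfun x)) _.
  by rewrite -[_ *: _]/(_ * _) mulr1.
have -> := is_derive_unique_pos x0 f1E da (is_derive_add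
  (is_derive_cstl 2^-1 (is_derive_mul (df x0) dV)) (is_derive_cst (2^-1 * c) _ _)).
have -> : f x = 2 * x * f1 x - x * c by have := ode x0; lra.
by field.
Qed.

End OdeSqrt.

Section AffineSqrt.
Variables (g g1 : R -> R).
Hypothesis dg : forall y : R, 0 < y -> is_derive y 1 g (g1 y).

Lemma affine_sqrt (k : R) : (forall y : R, 0 < y -> g1 y * sqrt y = k) ->
  forall y : R, 0 < y -> g y = g 1 + 2 * k * (sqrt y - 1).
Proof.
move=> gk y y0.
have H : g y - 2 * k * sqrt y = g 1 - 2 * k * sqrt 1.
  apply: (eq_increment_pos (f := g) (g := fun y => 2 * k * sqrt y) (f' := g1))
    ltr01 => // z z0.
  apply: is_derive_eval (is_derive_cstl _ (is_derive_sqrt z0)) _.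
  by rewrite -(gk z z0); field; exact: sqrt_gt0_neq0.
by rewrite sqrtr1 in H; lra.
Qed.

Variables (a b : R).
Hypothesis gE : forall y : R, 0 < y -> g y = a + b * sqrt y.

Lemma affine_sqrt_derive (y : R) : 0 < y -> g1 y = 2^-1 * b * (sqrt y)^-1.
Proof.
move=> y0; have -> := is_derive_unique_pos y0 gE (dg y0) (is_derive_add
  (is_derive_cst a _ _) (is_derive_cstl b (is_derive_sqrt y0))).
by field; exact: sqrt_gt0_neq0.
Qed.

(** Both 1 and sqrt y lie in the kernel of the operator g'/4 + y g''/2. *)
Lemma affine_sqrt_heat (y c : R) : 0 < y -> is_derive y 1 g1 c ->
  g1 y / 4 + y / 2 * c = 0.
Proof.
move=> y0 dc; rewrite (affine_sqrt_derive y0).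
have -> := is_derive_unique_pos y0 affine_sqrt_derive dc
  (is_derive_cstl _ (is_derive_inv_sqrt y0)).
by field; rewrite sqrt_gt0_neq0 //= lt0r_neq0.
Qed.

End AffineSqrt.

End SolvingTheEquations.

(** * Integration of the determining equations *)

Section GeneralSolution.
Variable R : realType.
Local Notation sqrt := (@Num.sqrt R).
Variables (X Y L Xx Xy Xt Xxx Xyy Yx Yy Yt Yxx Yyy Lx Ly Lt Lxx Lyy :
  R -> R -> R -> R) (T T1 T2 K1 : R -> R).

Let pd1 (f f1 : R -> R -> R -> R) := forall x y t : R, 0 < x -> 0 < y ->
  is_derive x 1 (fun x => f x y t) (f1 x y t).
Let pd2 (f f1 : R -> R -> R -> R) := forall x y t : R, 0 < x -> 0 < y ->
  is_derive y 1 (fun y => f x y t) (f1 x y t).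
Let pd3 (f f1 : R -> R -> R -> R) := forall x y t : R, 0 < x -> 0 < y ->
  is_derive t 1 (fun t => f x y t) (f1 x y t).

Hypotheses (dXx : pd1 X Xx) (dXy : pd2 X Xy) (dXt : pd3 X Xt)
  (dXxx : pd1 Xx Xxx) (dXyy : pd2 Xy Xyy).
Hypotheses (dYx : pd1 Y Yx) (dYy : pd2 Y Yy) (dYt : pd3 Y Yt)
  (dYxx : pd1 Yx Yxx) (dYyy : pd2 Yy Yyy).
Hypotheses (dLx : pd1 L Lx) (dLy : pd2 L Ly) (dLt : pd3 L Lt)
  (dLxx : pd1 Lx Lxx) (dLyy : pd2 Ly Lyy).
Hypotheses (dT : forall t : R, is_derive t 1 T (T1 t))
  (dT1 : forall t : R, is_derive t 1 T1 (T2 t))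
  (dK : forall t : R, is_derive t 1 (Yx 1 1) (K1 t)).

Hypothesis e0 : forall x y t : R, 0 < x -> 0 < y ->
  x * Yx x y t + y * Xy x y t = 0.
Hypothesis e1 : forall x y t : R, 0 < x -> 0 < y ->
  X x y t - 2 * x * Xx x y t + x * T1 t = 0.
Hypothesis e2 : forall x y t : R, 0 < x -> 0 < y ->
  Y x y t - 2 * y * Yy x y t + y * T1 t = 0.
Hypothesis e3 : forall x y t : R, 0 < x -> 0 < y ->
  - Xx x y t / 4 - Xy x y t / 4 + x / 2 * (2 * Lx x y t - Xxx x y t)
  - y / 2 * Xyy x y t - Xt x y t + T1 t / 4 = 0.
Hypothesis e4 : forall x y t : R, 0 < x -> 0 < y ->
  - Yx x y t / 4 - Yy x y t / 4 - x / 2 * Yxx x y t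
  + y / 2 * (2 * Ly x y t - Yyy x y t) - Yt x y t + T1 t / 4 = 0.
Hypothesis e5 : forall x y t : R, 0 < x -> 0 < y ->
  (Lx x y t + Ly x y t) / 4 + x / 2 * Lxx x y t + y / 2 * Lyy x y t
  + Lt x y t = 0.

(** [K], [A] and [B] are the unknown functions of t in [XE] and [YE], solved for from X, Y and Y_x
    at x = y = 1; [A1] and [B1] are the derivatives of [A] and [B]. *)
Let K := Yx 1 1.
Let A t := X 1 1 t - T1 t + 2 * K t.
Let A1 t := Xt 1 1 t - T2 t + 2 * K1 t.
Let B t := Y 1 1 t - T1 t - 2 * K t.
Let B1 t := Yt 1 1 t - T2 t - 2 * K1 t.

Let XE0 (x y t : R) : 0 < x -> 0 < y ->
  X x y t = sqrt x * (T1 t * sqrt x + X 1 y t - T1 t).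
Proof.
move=> x0 y0; apply: (ode_sqrt (f := fun x => X x y t)
    (f1 := fun x => Xx x y t)) => // z z0.
  exact: dXx.
exact: e1.
Qed.

Let YE0 (x y t : R) : 0 < x -> 0 < y ->
  Y x y t = sqrt y * (T1 t * sqrt y + Y x 1 t - T1 t).
Proof.
move=> x0 y0; apply: (ode_sqrt (f := fun y => Y x y t)
    (f1 := fun y => Yy x y t)) => // z z0.
  exact: dYy.
exact: e2.
Qed.

(** In [XE0] only the value at x = 1 depends on y. *)
Let XyE (x y t : R) : 0 < x -> 0 < y -> Xy x y t = sqrt x * Xy 1 y t.
Proof.
move=> x0 y0.
have H z : 0 < z -> X x z t = sqrt x * (T1 t * sqrt x - T1 t) + sqrt x * X 1 z t.
  by move=> z0; rewrite XE0 //; ring.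
rewrite (is_derive_unique_pos y0 H (dXy t x0 y0) (is_derive_add
  (is_derive_cst _ _ _) (is_derive_cstl _ (dXy t ltr01 y0)))).
by rewrite add0r.
Qed.

Let YxE (x y t : R) : 0 < x -> 0 < y -> Yx x y t = sqrt y * Yx x 1 t.
Proof.
move=> x0 y0.
have H z : 0 < z -> Y z y t = sqrt y * (T1 t * sqrt y - T1 t) + sqrt y * Y z 1 t.
  by move=> z0; rewrite YE0 //; ring.
rewrite (is_derive_unique_pos x0 H (dYx t x0 y0) (is_derive_add
  (is_derive_cst _ _ _) (is_derive_cstl _ (dYx t x0 ltr01)))).
by rewrite add0r.
Qed.

(** At x = 1, [e0] and [YxE] give sqrt y X_y(1, y, t) = - K(t), which [affine_sqrt] integrates. *)
Let XE (x y t : R) : 0 < x -> 0 < y ->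
  X x y t = T1 t * x + sqrt x * (A t - 2 * K t * sqrt y).
Proof.
move=> x0 y0; rewrite XE0 //.
have -> : X 1 y t = X 1 1 t + 2 * - K t * (sqrt y - 1).
  apply: (affine_sqrt (g := fun y => X 1 y t)
    (g1 := fun y => Xy 1 y t)) => // z z0.
    exact: dXy.
  have := e0 t ltr01 z0; rewrite mul1r YxE // -/(K t) => H.
  apply: (mulfI (sqrt_gt0_neq0 z0)).
  by rewrite mulrCA -expr2 sqr_sqrtr ?ltW //; lra.
have -> : T1 t * x = T1 t * sqrt x ^+ 2 by rewrite sqr_sqrtr ?ltW.
by rewrite /A; ring.
Qed.

Let YE (x y t : R) : 0 < x -> 0 < y ->
  Y x y t = T1 t * y + sqrt y * (B t + 2 * K t * sqrt x).
Proof.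
move=> x0 y0; rewrite YE0 //.
have Xy11 : Xy 1 1 t = - K t by have := e0 t ltr01 ltr01; rewrite /K; lra.
have -> : Y x 1 t = Y 1 1 t + 2 * K t * (sqrt x - 1).
  apply: (affine_sqrt (g := fun x => Y x 1 t)
    (g1 := fun x => Yx x 1 t)) => // z z0.
    exact: dYx.
  have := e0 t z0 ltr01; rewrite mul1r XyE // Xy11 => H.
  apply: (mulfI (sqrt_gt0_neq0 z0)).
  by rewrite mulrCA -expr2 sqr_sqrtr ?ltW //; lra.
have -> : T1 t * y = T1 t * sqrt y ^+ 2 by rewrite sqr_sqrtr ?ltW.
by rewrite /B; ring.
Qed.

Let dA (t : R) : is_derive t 1 A (A1 t).
Proof.
exact: is_derive_add (is_derive_add (dXt t ltr01 ltr01)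
  (is_derive_opp (dT1 t))) (is_derive_cstl _ (dK t)).
Qed.

Let dB (t : R) : is_derive t 1 B (B1 t).
Proof.
exact: is_derive_add (is_derive_add (dYt t ltr01 ltr01)
  (is_derive_opp (dT1 t))) (is_derive_opp (is_derive_cstl _ (dK t))).
Qed.

Let is_derive_cstr (c : R) (f : R -> R) (x a : R) :
  is_derive x 1 f a -> is_derive x 1 (fun z => f z * c) (a * c).
Proof.
move=> df; apply: is_derive_eval (is_derive_mul df (is_derive_cst c x 1)) _.
by rewrite mulr0 add0r mulrC.
Qed.

Let XtE (x y t : R) : 0 < x -> 0 < y ->
  Xt x y t = T2 t * x + sqrt x * (A1 t - 2 * K1 t * sqrt y).
Proof.
move=> x0 y0; apply: is_derive_unique (dXt t x0 y0) _.
rewrite (_ : (fun t => X x y t) =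
    fun t => T1 t * x + sqrt x * (A t + - (2 * K t * sqrt y))); last first.
  by apply/funext => s; exact: XE.
apply: is_derive_add (is_derive_cstr x (dT1 t)) (is_derive_cstl _ _).
apply: is_derive_add (dA t) (is_derive_opp _).
exact: is_derive_cstr (is_derive_cstl _ (dK t)).
Qed.

Let YtE (x y t : R) : 0 < x -> 0 < y ->
  Yt x y t = T2 t * y + sqrt y * (B1 t + 2 * K1 t * sqrt x).
Proof.
move=> x0 y0; apply: is_derive_unique (dYt t x0 y0) _.
rewrite (_ : (fun t => Y x y t) =
    fun t => T1 t * y + sqrt y * (B t + (2 * K t * sqrt x))); last first.
  by apply/funext => s; exact: YE.
apply: is_derive_add (is_derive_cstr y (dT1 t)) (is_derive_cstl _ _).
apply: is_derive_add (dB t) _.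
exact: is_derive_cstr (is_derive_cstl _ (dK t)).
Qed.

(** In [e3] the terms in X_x and X_xx add up to - T1/4 and cancel the last term, and those in X_y
    and X_yy cancel each other. Only x L_x - X_t remains. *)
Let LxE (x y t : R) : 0 < x -> 0 < y -> x * Lx x y t = Xt x y t.
Proof.
move=> x0 y0; have := e3 t x0 y0.
have := ode_sqrt_heat (f := fun x => X x y t) (f1 := fun x => Xx x y t)
  (fun z z0 => dXx t z0 y0) (fun z z0 => e1 t z0 y0) x0 (dXxx t x0 y0).
have XyL z : 0 < z ->
    X x z t = (T1 t * x + sqrt x * A t) + sqrt x * (- 2 * K t) * sqrt z.
  by move=> z0; rewrite XE //; ring.
have := affine_sqrt_heat (g := fun y => X x y t) (g1 := fun y => Xy x y t)
  (fun z z0 => dXy t x0 z0) XyL y0 (dXyy t x0 y0).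
lra.
Qed.

Let LyE (x y t : R) : 0 < x -> 0 < y -> y * Ly x y t = Yt x y t.
Proof.
move=> x0 y0; have := e4 t x0 y0.
have := ode_sqrt_heat (f := fun y => Y x y t) (f1 := fun y => Yy x y t)
  (fun z z0 => dYy t x0 z0) (fun z z0 => e2 t x0 z0) y0 (dYyy t x0 y0).
have YxL z : 0 < z ->
    Y z y t = (T1 t * y + sqrt y * B t) + sqrt y * (2 * K t) * sqrt z.
  by move=> z0; rewrite YE //; ring.
have := affine_sqrt_heat (g := fun x => Y x y t) (g1 := fun x => Yx x y t)
  (fun z z0 => dYx t z0 y0) YxL x0 (dYxx t x0 y0).
lra.
Qed.

Let primitive_sqrt (f f1 : R -> R) (a b : R) :
  (forall x : R, 0 < x -> is_derive x 1 f (f1 x)) ->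
  (forall x : R, 0 < x -> x * f1 x = a * x + sqrt x * b) ->
  forall x : R, 0 < x -> f x = f 1 + a * (x - 1) + 2 * b * (sqrt x - 1).
Proof.
move=> df f1E x x0.
have H : f x - (a * x + 2 * b * sqrt x) = f 1 - (a * 1 + 2 * b * sqrt 1).
  apply: (eq_increment_pos (f := f) (g := fun x => a * x + 2 * b * sqrt x)
    (f' := f1)) ltr01 => // z z0.
  apply: is_derive_eval (is_derive_add (is_derive_cstl _ (is_derive_idfun z))
    (is_derive_cstl _ (is_derive_sqrt z0))) _.
  apply: (mulfI (lt0r_neq0 z0)); rewrite f1E //.
  have := sqr_sqrtr (ltW z0); have := sqrt_gt0_neq0 z0.
  by move: (sqrt z) => s sn <-; field.
by rewrite sqrtr1 in H; lra.
Qed.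

(** This integrates L_x = X_t / x from 1 to x, with X_t taken from [XtE]. *)
Let LE1 (x y t : R) : 0 < x -> 0 < y ->
  L x y t = L 1 y t + T2 t * (x - 1)
    + 2 * (A1 t - 2 * K1 t * sqrt y) * (sqrt x - 1).
Proof.
move=> x0 y0; apply: (primitive_sqrt (f := fun x => L x y t)
  (f1 := fun x => Lx x y t)) => // z z0; first exact: dLx.
by rewrite LxE // XtE.
Qed.

Let LE2 (x y t : R) : 0 < x -> 0 < y ->
  L x y t = L x 1 t + T2 t * (y - 1)
    + 2 * (B1 t + 2 * K1 t * sqrt x) * (sqrt y - 1).
Proof.
move=> x0 y0; apply: (primitive_sqrt (f := fun y => L x y t)
  (f1 := fun y => Ly x y t)) => // z z0; first exact: dLy.
by rewrite LyE // YtE.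
Qed.

(** The sample points below are squares, so that their roots are explicit and the relations become
    linear. *)
Let sqr_gt0 (a : R) : 0 < a -> 0 < a ^+ 2. Proof. exact: exprn_gt0. Qed.

Let sqrt_sqr (a : R) : 0 < a -> sqrt (a ^+ 2) = a.
Proof. by move=> a0; rewrite sqrtr_sqr gtr0_norm. Qed.

(* [LE1] and [LE2] give opposite values to the mixed second difference of L. *)
Let K1_eq0 t : K1 t = 0.
Proof.
have p2 : 0 < 2 :> R by [].
have s4 := sqr_gt0 p2.
have := LE1 t s4 s4; have := LE1 t s4 ltr01.
have := LE2 t s4 s4; have := LE2 t ltr01 s4.
rewrite !sqrt_sqr // !sqrtr1; lra.
Qed.

Let LE (x y t : R) : 0 < x -> 0 < y ->
  L x y t = L 1 1 t + T2 t * (x - 1) + T2 t * (y - 1)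
    + 2 * A1 t * (sqrt x - 1) + 2 * B1 t * (sqrt y - 1).
Proof.
move=> x0 y0; rewrite LE1 // (LE2 t ltr01 y0) K1_eq0 sqrtr1; ring.
Qed.

(** The operator f/4 + x f'/2 annihilates 1 / sqrt x, so only the constant part [a] of f
    contributes. *)
Let heat_inv_sqrt (f f1 : R -> R) (a b : R) :
  (forall x : R, 0 < x -> x * f x = a * x + sqrt x * b) ->
  forall x : R, 0 < x -> is_derive x 1 f (f1 x) ->
  f x / 4 + x / 2 * f1 x = a / 4.
Proof.
move=> fE x x0 df.
have fE' z : 0 < z -> f z = a + b * (sqrt z)^-1.
  move=> z0; apply: (mulfI (lt0r_neq0 z0)); rewrite fE //.
  have := sqr_sqrtr (ltW z0); have := sqrt_gt0_neq0 z0.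
  by move: (sqrt z) => s sn <-; field.
rewrite fE' // (is_derive_unique_pos x0 fE' df (is_derive_add
  (is_derive_cst _ _ _) (is_derive_cstl _ (is_derive_inv_sqrt x0)))).
by field; rewrite sqrt_gt0_neq0 //= lt0r_neq0.
Qed.

Let LtE (x y t : R) : 0 < x -> 0 < y -> Lt x y t = - 2^-1 * T2 t.
Proof.
move=> x0 y0; have := e5 t x0 y0.
have HX z : 0 < z -> z * Lx z y t = T2 t * z + sqrt z * A1 t.
  by move=> z0; rewrite LxE // XtE // K1_eq0; ring.
have HY z : 0 < z -> z * Ly x z t = T2 t * z + sqrt z * B1 t.
  by move=> z0; rewrite LyE // YtE // K1_eq0; ring.
have := heat_inv_sqrt (f1 := fun x => Lxx x y t) HX x0 (dLxx t x0 y0).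
have := heat_inv_sqrt (f1 := fun y => Lyy x y t) HY y0 (dLyy t x0 y0).
lra.
Qed.

(** By [LtE] the sum L + T1/2 is constant in t; hence differences of L between two space points do
    not depend on t. *)
Let LtE' (x y t : R) : 0 < x -> 0 < y ->
  L x y t + 2^-1 * T1 t = L x y 0 + 2^-1 * T1 0.
Proof.
move=> x0 y0.
have dL (s : R) : is_derive s 1 (fun t => L x y t) (- 2^-1 * T2 s).
  by rewrite -(@LtE x y) //; exact: dLt.
have dR (s : R) : is_derive s 1 (fun t => - 2^-1 * T1 t) (- 2^-1 * T2 s).
  exact: is_derive_cstl (dT1 s).
by have := eq_increment dL dR t 0; rewrite !mulNr !opprK.
Qed.

(** By [LE] the difference L(x, 1, t) - L(1, 1, t) is T2 (x - 1) + 2 A1 (sqrt x - 1), and by [LtE']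
    it does not depend on t. The points sqrt x = 2 and sqrt x = 3 separate the two coefficients. *)
Let T2E t : T2 t = T2 0.
Proof.
have p2 : 0 < 2 :> R by [].
have p3 : 0 < 3 :> R by [].
have := LE t (sqr_gt0 p2) ltr01; have := LE 0 (sqr_gt0 p2) ltr01.
have := LE t (sqr_gt0 p3) ltr01; have := LE 0 (sqr_gt0 p3) ltr01.
have := LtE' t (sqr_gt0 p2) ltr01; have := LtE' t (sqr_gt0 p3) ltr01.
have := LtE' t ltr01 ltr01.
rewrite !sqrt_sqr // !sqrtr1; lra.
Qed.

Let A1E t : A1 t = A1 0.
Proof.
have p2 : 0 < 2 :> R by [].
have := LE t (sqr_gt0 p2) ltr01; have := LE 0 (sqr_gt0 p2) ltr01.
have := LtE' t (sqr_gt0 p2) ltr01; have := LtE' t ltr01 ltr01.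
rewrite (T2E t) !sqrt_sqr // !sqrtr1; lra.
Qed.

Let B1E t : B1 t = B1 0.
Proof.
have p2 : 0 < 2 :> R by [].
have := LE t ltr01 (sqr_gt0 p2); have := LE 0 ltr01 (sqr_gt0 p2).
have := LtE' t ltr01 (sqr_gt0 p2); have := LtE' t ltr01 ltr01.
rewrite (T2E t) !sqrt_sqr // !sqrtr1; lra.
Qed.

Let affine_of_derive (f : R -> R) (a : R) :
  (forall t : R, is_derive t 1 f a) -> forall t, f t = a * t + f 0.
Proof.
move=> df t.
have dg (s : R) : is_derive s 1 (fun t : R => a * t) a.
  by apply: is_derive_eval (is_derive_cstl a (is_derive_idfun s)) _; rewrite mulr1.
by have := eq_increment df dg t 0; rewrite mulr0 subr0 => <-; rewrite addrC subrK.
Qed.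

Lemma general_solution : exists c1 c2 c3 c4 c5 c6 c7 c8 c9 : R,
  (forall t, T t = c1 * t ^+ 2 + c2 * t + c3) /\
  forall x y t : R, 0 < x -> 0 < y ->
  [/\ X x y t = (2 * c1 * t + c2) * x + sqrt x * (c4 * sqrt y + c5 * t + c6),
    Y x y t = (2 * c1 * t + c2) * y + sqrt y * (- c4 * sqrt x + c7 * t + c8)
  & L x y t = 2 * c1 * (x + y) + 2 * c5 * sqrt x + 2 * c7 * sqrt y
      + c9 - c1 * t].
Proof.
have KE t : K t = K 0.
  have dK0 (s : R) : is_derive s 1 K 0 by rewrite -(K1_eq0 s).
  by rewrite (affine_of_derive dK0 t) mul0r add0r.
have AE : forall t, A t = A1 0 * t + A 0.
  by apply: affine_of_derive => s; rewrite -(A1E s).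
have BE : forall t, B t = B1 0 * t + B 0.
  by apply: affine_of_derive => s; rewrite -(B1E s).
have T1E : forall t, T1 t = T2 0 * t + T1 0.
  by apply: affine_of_derive => s; rewrite -(T2E s).
have TE t : T t = T2 0 / 2 * t ^+ 2 + T1 0 * t + T 0.
  have dg (s : R) : is_derive s 1 (fun t : R => T2 0 / 2 * (t * t) + T1 0 * t) (T1 s).
    apply: is_derive_eval (is_derive_add
      (is_derive_cstl _ (is_derive_mul (is_derive_idfun s) (is_derive_idfun s)))
      (is_derive_cstl _ (is_derive_idfun s))) _.
    by rewrite (T1E s); field.
  have := eq_increment dT dg t 0; rewrite !mulr0 !addr0 subr0 => <-.
  by rewrite expr2; ring.
(* These are the Taylor coefficients of T, A and B at 0, and [- 2 * K 0] for the rotation. The last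
   constant makes the formula for L correct at (1, 1, 0). *)
exists (T2 0 / 2), (T1 0), (T 0), (- 2 * K 0), (A1 0), (A 0), (B1 0), (B 0),
  (L 1 1 0 - 2 * T2 0 - 2 * A1 0 - 2 * B1 0).
split=> // x y t x0 y0; split.
- by rewrite XE // (KE t) (AE t) (T1E t); field.
- by rewrite YE // (KE t) (BE t) (T1E t); field.
- have := LtE' t ltr01 ltr01; rewrite (T1E t) => H.
  by rewrite LE // (T2E t) (A1E t) (B1E t); lra.
Qed.

End GeneralSolution.

(** * Symbolic expressions closed under differentiation *)

Section Expressions.
Variable R : realType.
Implicit Types (m w : base R) (b : bool).

Definition idx b : 'I_3 := if b then ix else iy.

(* Scalar functions on [dom] generated by t, u, sqrt x, sqrt y and their
   inverses; [b] selects between x and y. *)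
Inductive sexpr :=
  | Cst of R | Tm | Un | Sq of bool | Si of bool
  | Ad of sexpr & sexpr | Ml of sexpr & sexpr.

Fixpoint ev (e : sexpr) m : R :=
  match e with
  | Cst r => r
  | Tm => m.1 0 it
  | Un => m.2
  | Sq b => Num.sqrt (m.1 0 (idx b))
  | Si b => (Num.sqrt (m.1 0 (idx b)))^-1
  | Ad e f => ev e m + ev f m
  | Ml e f => ev e m * ev f m
  end.

(** The derivative along the constant vector [w] stays in the syntax. Smoothness is then an instance
    of [Cn_family], and iterated derivatives are obtained by reduction. *)
Fixpoint ed w (e : sexpr) : sexpr :=
  match e with
  | Cst _ => Cst 0
  | Tm => Cst (w.1 0 it)
  | Un => Cst w.2
  | Sq b => Ml (Cst (w.1 0 (idx b) / 2)) (Si b)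
  | Si b => Ml (Cst (- w.1 0 (idx b) / 2)) (Ml (Si b) (Ml (Si b) (Si b)))
  | Ad e f => Ad (ed w e) (ed w f)
  | Ml e f => Ad (Ml e (ed w f)) (Ml f (ed w e))
  end.

Lemma dom_idx b m : dom R m -> 0 < m.1 0 (idx b).
Proof. by case: b => -[]. Qed.

(** Along a line the coordinate is affine with slope [w.1 0 k], so the one-variable chain rule
    applies. *)
Lemma is_derive_coord_comp (f : R -> R) m w k a :
  is_derive (m.1 0 k : R) 1 f a ->
  is_derive m w (fun m => f (m.1 0 k)) (w.1 0 k * a).
Proof.
move=> df; apply/is_derive_line.
rewrite (_ : (fun h => _) = f \o (fun h : R => h * w.1 0 k + m.1 0 k)); last first.
  by apply/funext => h /=; rewrite !mxE.
rewrite mulrC; apply: is_derive1_comp; first by rewrite mul0r add0r.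
have dl (c d : R) : is_derive (0 : R) 1 (fun h : R => h * c + d) c.
  have H := is_derive_add (is_derive_mul (is_derive_idfun (0 : R))
    (is_derive_cst c (0 : R) 1)) (is_derive_cst d (0 : R) 1).
  by apply: is_derive_eval H _; rewrite mulr0 add0r mulr1 addr0.
exact: dl.
Qed.

Lemma is_derive_ev e m w : dom R m -> is_derive m w (ev e) (ev (ed w e) m).
Proof.
move=> dm; elim: e => [r|||b|b|e de f df|e de f df] /=.
- exact: is_derive_cst.
- exact: (is_derive_clinear m w (clinear_base R it)).
- exact: (is_derive_clinear m w (@clinear_snd R _ _)).
- apply: is_derive_eq (is_derive_coord_comp w
    (is_derive_sqrt (dom_idx b dm))) _.
  by rewrite invfM mulrA.
- apply: is_derive_eq (is_derive_coord_comp w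
    (is_derive_inv_sqrt (dom_idx b dm))) _.
  have := dom_idx b dm; move: (m.1 0 _) (w.1 0 _) => x z x0.
  have := sqr_sqrtr (ltW x0); have := sqrt_gt0_neq0 x0.
  by move: (Num.sqrt x) => s sn <-; field.
- exact: is_derive_add.
- exact: is_derive_mul.
Qed.

Lemma continuous_ev e m : dom R m -> {for m, continuous (ev e)}.
Proof.
move=> dm; have ck k : {for m, continuous (fun m : base R => m.1 0 k : R)}.
  exact: (clinear_base R k).2.
have cs b : {for m, continuous (fun m : base R => Num.sqrt (m.1 0 (idx b)))}.
  by apply: continuous_comp; [exact: ck|exact: sqrt_continuous].
elim: e => [r|||b|b|e de f df|e de f df] /=.
- exact: cvg_cst.
- exact: ck.
- exact: (@clinear_snd R _ _).2.
- exact: cs.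
- by apply: continuousV (cs b); rewrite sqrt_gt0_neq0 // dom_idx.
- exact: continuousD.
- exact: continuousM.
Qed.

Lemma Cn_ev e n : Cn (dom R) n (ev e).
Proof.
apply: (Cn_family (@open_dom R) (d := ed)) => [f m|f w m].
  exact: continuous_ev.
exact: is_derive_ev.
Qed.

Lemma dd_ev w e m : dom R m -> dd w (ev e) m = ev (ed w e) m.
Proof. by move=> dm; have [_] := is_derive_ev e w dm. Qed.

Lemma dd_ext w (f g : base R -> R) m : (forall m, dom R m -> f m = g m) ->
  dom R m -> dd w f m = dd w g m.
Proof.
by move=> fg dm; apply: near_eq_derive; apply: near_open_eq (@open_dom R) dm fg.
Qed.

Lemma valL_dom (v : vfield R) m (dm : dom R m) :
  'valL_0 v m = v (exist _ m (mem_set dm)).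
Proof. exact: (congr1 (@^~ (exist _ m (mem_set dm))) (@valLK _ _ 0 _ v)). Qed.

Lemma valL_val (v : vfield R) (m : dom R) : 'valL_0 v (val m) = v m.
Proof. exact: (congr1 (@^~ m) (@valLK _ _ 0 _ v)). Qed.

Lemma dom_val (m : dom R) : dom R (val m).
Proof. exact/set_mem/valP. Qed.

Lemma base_eqP (p q : base R) : p.1 0 ix = q.1 0 ix -> p.1 0 iy = q.1 0 iy ->
  p.1 0 it = q.1 0 it -> p.2 = q.2 -> p = q.
Proof.
case: p q => [p1 p2] [q1 q2] /= hx hy ht ->; congr pair; apply/rowP.
case=> [[|[|[|//]]]] k3.
- by rewrite (_ : Ordinal k3 = ix) //; exact/val_inj.
- by rewrite (_ : Ordinal k3 = iy) //; exact/val_inj.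
- by rewrite (_ : Ordinal k3 = it) //; exact/val_inj.
Qed.

End Expressions.

(** * Combinations of the nine fields as solutions of the symmetry condition *)

Section SymmetryAlgebra.
Variable R : realType.
Implicit Types (c d : 'I_9 -> R) (m w : base R).

Definition gsym c : vfield R := \sum_(i < 9) c i *: @vsym R i.

(** Here [c i] multiplies v_(i+1). The coordinates x and y are entered as squares of their roots, so
    that all later identities are rational in sqrt x and sqrt y. *)
Definition eX c :=
  Ad (Ml (Ad (Ml (Cst (2 * c 0)) (Tm R)) (Cst (c 1))) (Ml (Sq R true) (Sq R true)))
     (Ml (Sq R true) (Ad (Ml (Cst (c 3)) (Sq R false))
        (Ad (Ml (Cst (c 4)) (Tm R)) (Cst (c 5))))).
Definition eY c :=
  Ad (Ml (Ad (Ml (Cst (2 * c 0)) (Tm R)) (Cst (c 1))) (Ml (Sq R false) (Sq R false)))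
     (Ml (Sq R false) (Ad (Ml (Cst (- c 3)) (Sq R true))
        (Ad (Ml (Cst (c 6)) (Tm R)) (Cst (c 7))))).
Definition eT c :=
  Ad (Ml (Cst (c 0)) (Ml (Tm R) (Tm R))) (Ad (Ml (Cst (c 1)) (Tm R)) (Cst (c 2))).
Definition eL c :=
  Ml (Ad (Ml (Cst (2 * c 0))
        (Ad (Ml (Sq R true) (Sq R true)) (Ml (Sq R false) (Sq R false))))
     (Ad (Ml (Cst (2 * c 4)) (Sq R true)) (Ad (Ml (Cst (2 * c 6)) (Sq R false))
        (Ad (Cst (c 8)) (Ml (Cst (- c 0)) (Tm R)))))) (Un R).

Definition eV c (k : 'I_3) := nth (Cst 0) [:: eX c; eY c; eT c] k.

Lemma sum9E (V : nmodType) (F : 'I_9 -> V) : \sum_(i < 9) F i =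
  F 0 + F 1 + F 2 + F 3 + F 4 + F 5 + F 6 + F 7 + F 8.
Proof.
rewrite !big_ord_recl big_ord0 addr0 !addrA.
by do !congr (_ + _); congr F; exact/val_inj.
Qed.

Lemma gsym_val c (m : dom R) : [/\ (gsym c m).1 0 ix = ev (eX c) (val m),
  (gsym c m).1 0 iy = ev (eY c) (val m), (gsym c m).1 0 it = ev (eT c) (val m)
  & (gsym c m).2 = ev (eL c) (val m)].
Proof.
have [x0 y0] := dom_val m.
have sx := sqr_sqrtr (ltW x0); have sy := sqr_sqrtr (ltW y0).
have E : gsym c m = c 0 *: @vsym R 0 m + c 1 *: @vsym R 1 m + c 2 *: @vsym R 2 m
    + c 3 *: @vsym R 3 m + c 4 *: @vsym R 4 m + c 5 *: @vsym R 5 m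
    + c 6 *: @vsym R 6 m + c 7 *: @vsym R 7 m + c 8 *: @vsym R 8 m.
  by rewrite /gsym sum9E.
rewrite E /vsym /= /vsym1 /vsym2 /vsym3 /vsym4 /vsym5 /vsym6 /vsym7 /vsym8 /vsym9.
have scE (a b : R) : a *: b = a * b by [].
rewrite /vf_of; split; rewrite /= ?mxE /= -?expr2 ?sx ?sy ?scE; ring.
Qed.

Lemma xi_gsym c k m : dom R m -> xi (gsym c) k m = ev (eV c k) m.
Proof.
move=> dm; rewrite /xi (valL_dom _ dm).
have [hx hy ht _] := gsym_val c (exist _ m (mem_set dm)).
case: k => [[|[|[|//]]]] k3; rewrite /eV /=.
- by rewrite -[RHS]hx; congr (_ _ _); exact/val_inj.
- by rewrite -[RHS]hy; congr (_ _ _); exact/val_inj.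
- by rewrite -[RHS]ht; congr (_ _ _); exact/val_inj.
Qed.

Lemma phi_gsym c m : dom R m -> phi (gsym c) m = ev (eL c) m.
Proof.
move=> dm; rewrite /phi (valL_dom _ dm).
by have [_ _ _ ->] := gsym_val c (exist _ m (mem_set dm)).
Qed.

(** The field is a sum of scalar expressions times constant vectors, and each summand is an
    expression followed by a continuous linear map. *)
Lemma smooth_gsym c : smooth_on (dom R) ('valL_0 (gsym c)).
Proof.
move=> n.
have H w e : Cn (dom R) n (fun m => ev e m *: w : base R).
  exact: (Cn_clinear_comp (@open_dom R) (clinear_scale w) (Cn_ev e n)).
have := CnD (@open_dom R) (CnD (@open_dom R) (H (dz R ix) (eX c)) (H (dz R iy) (eY c)))
  (CnD (@open_dom R) (H (dz R it) (eT c)) (H (du R) (eL c))).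
apply: (Cn_ext (@open_dom R)) => m dm.
have E k : ('valL_0 (gsym c) m).1 0 k = _ := xi_gsym c k dm.
have F : ('valL_0 (gsym c) m).2 = _ := phi_gsym c dm.
apply: base_eqP; rewrite ?E ?F /= ?mxE /= ?mulr0 ?mulr1 ?add0r ?addr0 //.
by rewrite !scaler0 !add0r; exact: mulr1.
Qed.

Definition symbol_at (v : vfield R) m : R -> R -> R -> R -> R -> R -> R -> R -> R :=
  let f := phi v in let X := xi v ix in let Y := xi v iy in let T := xi v it in
  let D k (g : base R -> R) := dd (dz R k) g in let Du g := dd (du R) g in
  symbol (m.1 0 ix) (m.1 0 iy) (X m) (Y m)
    (D ix f m) (D iy f m) (D it f m) (Du f m)
    (D ix (D ix f) m) (D ix (Du f) m + Du (D ix f) m)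
    (D iy (D iy f) m) (D iy (Du f) m + Du (D iy f) m) (Du (Du f) m)
    (D ix X m) (D iy X m) (D it X m) (Du X m)
    (D ix (D ix X) m) (D ix (Du X) m + Du (D ix X) m)
    (D iy (D iy X) m) (D iy (Du X) m + Du (D iy X) m) (Du (Du X) m)
    (D ix Y m) (D iy Y m) (D it Y m) (Du Y m)
    (D ix (D ix Y) m) (D ix (Du Y) m + Du (D ix Y) m)
    (D iy (D iy Y) m) (D iy (Du Y) m + Du (D iy Y) m) (Du (Du Y) m)
    (D ix T m) (D iy T m) (D it T m) (Du T m)
    (D ix (D ix T) m) (D ix (Du T) m + Du (D ix T) m)
    (D iy (D iy T) m) (D iy (Du T) m + Du (D iy T) m) (Du (Du T) m).

Lemma pr2_pde_symbol v (j : jet2 R) : Cn (dom R) 2 ('valL_0 v) ->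
  dom R j.1.1 -> j.2^T = j.2 ->
  'D_(pr2 v j) (pde (1 / 4) 0 (1 / 4) 0) j =
  symbol_at v j.1.1 (j.1.2 0 ix) (j.1.2 0 iy) (j.1.2 0 it)
    (j.2 ix ix) (j.2 ix iy) (j.2 iy iy) (j.2 ix it) (j.2 iy it).
Proof.
move=> sv dj sj; have syx : j.2 iy ix = j.2 ix iy by rewrite -[in LHS]sj mxE.
rewrite pr2_pdeE !phi1E !phi2E // !sum3E syx.
by rewrite /symbol_at /symbol /prol1 /prol2.
Qed.

(** The third jet argument is u_t solved from the equation. Once all derivatives are computed
    symbolically, an identity of rational functions in the two roots remains. *)
Lemma symbol_gsym k m (p q a b c d e : R) : dom R m ->
  symbol_at (gsym k) m p q (- (1 / 4 * p + 1 / 4 * q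
    + m.1 0 ix / 2 * a + m.1 0 iy / 2 * c)) a b c d e = 0.
Proof.
move=> dm.
have Ex i w m' : dom R m' -> dd w (xi (gsym k) i) m' = ev (ed w (eV k i)) m'.
  move=> dm'; rewrite -dd_ev //; apply: dd_ext => // z dz.
  exact: xi_gsym.
have Exx i w w' : dd w' (dd w (xi (gsym k) i)) m = ev (ed w' (ed w (eV k i))) m.
  by rewrite -dd_ev //; apply: dd_ext => // z; exact: Ex.
have Ef w m' : dom R m' -> dd w (phi (gsym k)) m' = ev (ed w (eL k)) m'.
  move=> dm'; rewrite -dd_ev //; apply: dd_ext => // z dz.
  exact: phi_gsym.
have Eff w w' : dd w' (dd w (phi (gsym k))) m = ev (ed w' (ed w (eL k))) m.
  by rewrite -dd_ev //; apply: dd_ext => // z; exact: Ef.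
have E0 i : xi (gsym k) i m = ev (eV k i) m by exact: xi_gsym.
rewrite /symbol_at; move: (xi (gsym k)) (phi (gsym k)) E0 Ex Exx Ef Eff => F f.
move=> E0 Ex Exx Ef Eff; move: (@dd R) E0 Ex Exx Ef Eff => D E0 Ex Exx Ef Eff.
rewrite !Exx !Eff.
rewrite !Ex // !Ef // !E0; clear E0 Ex Exx Ef Eff F f D.
have [x0 y0] := dm.
have sx := sqr_sqrtr (ltW x0); have sy := sqr_sqrtr (ltW y0).
have nx := sqrt_gt0_neq0 x0; have ny := sqrt_gt0_neq0 y0.
rewrite /= ?mxE /=.
rewrite !(mulr0, mul0r, addr0, add0r, oppr0, mulr1, mul1r).
move: (m.1 0 it) (m.2) (m.1 0 ix) (m.1 0 iy) sx sy nx ny => t u x y.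
move: (Num.sqrt x) (Num.sqrt y) => s r <- <- nx ny.
move: (k 0) (k 1) (k 3) (k 4) (k 5) (k 6) (k 7) (k 8).
move=> k0 k1 k3 k4 k5 k6 k7 k8.
rewrite /symbol /prol1 /prol2; field.
by rewrite nx ny.
Qed.

End SymmetryAlgebra.

(** * Every linear symmetry is a combination of the nine fields *)

Section Classification.
Variable R : realType.
Implicit Types (c d : 'I_9 -> R) (m w : base R) (v : vfield R).
Local Notation LS := (linear_symmetries (1 / 4) 0 (1 / 4) 0 : set (vfield R)).

Lemma linear_symmetries_gsym c : LS (gsym c).
Proof.
split; last first.
  pose lam (z : 'rV[R]_3) : R := 2 * c 0 * (Num.sqrt (z 0 ix) * Num.sqrt (z 0 ix)
    + Num.sqrt (z 0 iy) * Num.sqrt (z 0 iy)) + (2 * c 4 * Num.sqrt (z 0 ix)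
    + (2 * c 6 * Num.sqrt (z 0 iy) + (c 8 + - c 0 * z 0 it))).
  by exists lam => m; have [_ _ _ ->] := gsym_val c m.
split; first exact: smooth_gsym.
move=> j dj sj ej; rewrite pr2_pde_symbol //; last exact: smooth_gsym.
have -> : j.1.2 0 it = - (1 / 4 * j.1.2 0 ix + 1 / 4 * j.1.2 0 iy
    + j.1.1.1 0 ix / 2 * j.2 ix ix + j.1.1.1 0 iy / 2 * j.2 iy iy).
  by move: ej; rewrite /pde; lra.
exact: symbol_gsym.
Qed.

Lemma scaleRE (a b : R) : a *: b = a * b. Proof. by []. Qed.

Definition pt (x y t u : R) : base R := (\row_i [:: x; y; t]`_i, u).

Lemma pt_dom x y t u : 0 < x -> 0 < y -> dom R (pt x y t u).
Proof. by split; rewrite mxE. Qed.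

Lemma is_derive_ptx (f : base R -> R) x y t u a :
  is_derive (pt x y t u) (dz R ix) f a ->
  is_derive (x : R) 1 (fun x => f (pt x y t u)) a.
Proof.
move=> /is_derive_line df; apply/is_derive_line.
rewrite (_ : (fun h => _) = fun h : R => f (h *: dz R ix + pt x y t u)) //.
apply/funext => h; congr f; apply: base_eqP; rewrite /= ?mxE /= ?scaleRE; lra.
Qed.

Lemma is_derive_pty (f : base R -> R) x y t u a :
  is_derive (pt x y t u) (dz R iy) f a ->
  is_derive (y : R) 1 (fun y => f (pt x y t u)) a.
Proof.
move=> /is_derive_line df; apply/is_derive_line.
rewrite (_ : (fun h => _) = fun h : R => f (h *: dz R iy + pt x y t u)) //.
apply/funext => h; congr f; apply: base_eqP; rewrite /= ?mxE /= ?scaleRE; lra.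
Qed.

Lemma is_derive_ptt (f : base R -> R) x y t u a :
  is_derive (pt x y t u) (dz R it) f a ->
  is_derive (t : R) 1 (fun t => f (pt x y t u)) a.
Proof.
move=> /is_derive_line df; apply/is_derive_line.
rewrite (_ : (fun h => _) = fun h : R => f (h *: dz R it + pt x y t u)) //.
apply/funext => h; congr f; apply: base_eqP; rewrite /= ?mxE /= ?scaleRE; lra.
Qed.

Lemma is_derive_ptu (f : base R -> R) x y t u a : is_derive (pt x y t u) (du R) f a ->
  is_derive (u : R) 1 (fun u => f (pt x y t u)) a.
Proof.
move=> /is_derive_line df; apply/is_derive_line.
rewrite (_ : (fun h => _) = fun h : R => f (h *: du R + pt x y t u)) //.
apply/funext => h; congr f; apply: base_eqP; rewrite /= ?mxE /= ?scaleRE; lra.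
Qed.

Section OneSymmetry.
Variable v : vfield R.
Hypothesis hv : LS v.

Let sv : smooth_on (dom R) ('valL_0 v). Proof. by case: hv => -[]. Qed.

(** Any choice of the jet variables is realised by a jet with symmetric second-order part; the entry
    u_tt, absent from the symbol, is set to 0. *)
Let symv m (p q r a b c d e : R) : dom R m ->
  1 / 4 * p + 1 / 4 * q + m.1 0 ix / 2 * a + m.1 0 iy / 2 * c + r = 0 ->
  symbol_at v m p q r a b c d e = 0.
Proof.
move=> dm E; have [[_ H] _] := hv.
pose s (i k : nat) :=
  nth 0 (nth [::] [:: [:: a; b; d]; [:: b; c; e]; [:: d; e; 0]] i) k.
pose j : jet2 R := ((m, \row_i [:: p; q; r]`_i), \matrix_(i, k) s i k).
have sj : j.2^T = j.2.
  apply/matrixP => i k; rewrite !mxE.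
  by case: i => [[|[|[|//]]]] ?; case: k => [[|[|[|//]]]] ?.
have := H j dm sj; rewrite pr2_pde_symbol // /j /= !mxE /s /=; apply.
by rewrite /pde /= !mxE /= /s /=; lra.
Qed.

Lemma symmetry_first_order m : dom R m ->
  [/\ dd (dz R ix) (xi v it) m = 0, dd (dz R iy) (xi v it) m = 0,
    dd (du R) (xi v it) m = 0 & [/\ dd (du R) (xi v ix) m = 0,
    dd (du R) (xi v iy) m = 0 & m.1 0 ix * dd (dz R ix) (xi v iy) m
      + m.1 0 iy * dd (dz R iy) (xi v ix) m = 0]].
Proof.
move=> dm; have [x0 y0] := dm.
have H p q r a b (c d e : R) := @symv m p q r a b c d e dm.
rewrite /symbol_at /= in H; exact: (sym_first_order x0 y0 H).
Qed.

Let dd0 w f m : (forall m, dom R m -> f m = 0) -> dom R m -> dd w f m = 0.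
Proof.
move=> f0 dm; rewrite (dd_ext (g := fun=> 0) w f0 dm).
exact: (derive_val (is_derive := is_derive_cst 0 m w)).
Qed.

(** The first-order equations hold on the whole open domain, so T_x and T_y can be differentiated
    there: this gives T_xx = T_yy = 0, as [sym_second_order] demands. *)
Lemma symmetry_second_order m : dom R m ->
  let D k (g : base R -> R) := dd (dz R k) g in let Du g := dd (du R) g in
  let f := phi v in let X := xi v ix in let Y := xi v iy in let T := xi v it in
  let x := m.1 0 ix in let y := m.1 0 iy in
  [/\ X m - 2 * x * D ix X m + x * D it T m = 0,
    Y m - 2 * y * D iy Y m + y * D it T m = 0,
    - D ix X m / 4 - D iy X m / 4
      + x / 2 * (D ix (Du f) m + Du (D ix f) m - D ix (D ix X) m)
      - y / 2 * D iy (D iy X) m - D it X m + D it T m / 4 = 0,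
    - D ix Y m / 4 - D iy Y m / 4 - x / 2 * D ix (D ix Y) m
      + y / 2 * (D iy (Du f) m + Du (D iy f) m - D iy (D iy Y) m)
      - D it Y m + D it T m / 4 = 0
    & (D ix f m + D iy f m) / 4 + x / 2 * D ix (D ix f) m
      + y / 2 * D iy (D iy f) m + D it f m = 0].
Proof.
move=> dm; have [x0 y0] := dm.
have Txx : dd (dz R ix) (dd (dz R ix) (xi v it)) m = 0.
  apply: (@dd0 _ (dd (dz R ix) (xi v it)) m _ dm) => z dz.
  by have [H _ _ _] := symmetry_first_order dz; exact: H.
have Tyy : dd (dz R iy) (dd (dz R iy) (xi v it)) m = 0.
  apply: (@dd0 _ (dd (dz R iy) (xi v it)) m _ dm) => z dz.
  by have [_ H _ _] := symmetry_first_order dz; exact: H.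
have H p q r a b (c d e : R) := @symv m p q r a b c d e dm.
rewrite /symbol_at /= in H; exact: (sym_second_order x0 y0 H Txx Tyy).
Qed.

Let Cx k : Cn (dom R) 2 (xi v k). Proof. exact: Cn_xi (sv 2). Qed.
Let Cp : Cn (dom R) 2 (phi v). Proof. exact: Cn_phi (sv 2). Qed.

Let d1 f w m : Cn (dom R) 2 f -> dom R m -> is_derive m w f (dd w f m).
Proof. exact: Cn_derivable. Qed.

Let d2 f w w' m : Cn (dom R) 2 f -> dom R m ->
  is_derive m w' (dd w f) (dd w' (dd w f) m).
Proof. by move=> Cf; apply: Cn_derivable; exact: Cn_derive Cf. Qed.

Let phi_lin x y t u : 0 < x -> 0 < y ->
  phi v (pt x y t u) = u * phi v (pt x y t 1).
Proof.
move=> x0 y0; have [_ [lam lamE]] := hv.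
have E u' : phi v (pt x y t u') = lam (pt x y t u').1 * u'.
  by rewrite /phi (valL_dom v (pt_dom t u' x0 y0)) lamE.
by rewrite !E mulr1 mulrC.
Qed.

Let Du_phi x y t u : 0 < x -> 0 < y ->
  dd (du R) (phi v) (pt x y t u) = phi v (pt x y t 1).
Proof.
move=> x0 y0.
apply: is_derive_unique (is_derive_ptu (d1 _ Cp (pt_dom t u x0 y0))) _.
rewrite (_ : (fun u => _) = fun u => phi v (pt x y t 1) * u); last first.
  by apply/funext => u'; rewrite phi_lin // mulrC.
by apply: is_derive_eval (is_derive_cstl _ (is_derive_idfun u)) _; rewrite mulr1.
Qed.

(** Since phi = u lambda, each of the two mixed derivatives equals lambda_x, the value of phi_x at u
    = 1. This produces the term 2 L_x of [general_solution]. *)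
Let DDx_phi x y t : 0 < x -> 0 < y -> let m := pt x y t 1 in
  dd (dz R ix) (dd (du R) (phi v)) m + dd (du R) (dd (dz R ix) (phi v)) m
  = 2 * dd (dz R ix) (phi v) m.
Proof.
move=> x0 y0 m; have dm := pt_dom t 1 x0 y0.
have -> : dd (dz R ix) (dd (du R) (phi v)) m = dd (dz R ix) (phi v) m.
  have H z : 0 < z -> dd (du R) (phi v) (pt z y t 1) = phi v (pt z y t 1).
    by move=> z0; rewrite Du_phi.
  exact: is_derive_unique_pos x0 H (is_derive_ptx (d2 _ _ Cp dm))
    (is_derive_ptx (d1 _ Cp dm)).
have -> : dd (du R) (dd (dz R ix) (phi v)) m = dd (dz R ix) (phi v) m.
  have H u : dd (dz R ix) (phi v) (pt x y t u) = dd (dz R ix) (phi v) m * u.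
    have E z : 0 < z -> phi v (pt z y t u) = u * phi v (pt z y t 1).
      by move=> z0; rewrite phi_lin.
    rewrite mulrC; apply: (is_derive_unique_pos x0 E).
      exact: is_derive_ptx (d1 _ Cp (pt_dom t u x0 y0)).
    exact: is_derive_cstl (is_derive_ptx (d1 _ Cp dm)).
  apply: is_derive_unique (is_derive_ptu (d2 _ _ Cp dm)) _.
  rewrite (_ : (fun u => _) = fun u => dd (dz R ix) (phi v) m * u); last first.
    exact/funext.
  by apply: is_derive_eval (is_derive_cstl _ (is_derive_idfun 1)) _; rewrite mulr1.
by ring.
Qed.

Let DDy_phi x y t : 0 < x -> 0 < y -> let m := pt x y t 1 in
  dd (dz R iy) (dd (du R) (phi v)) m + dd (du R) (dd (dz R iy) (phi v)) m
  = 2 * dd (dz R iy) (phi v) m.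
Proof.
move=> x0 y0 m; have dm := pt_dom t 1 x0 y0.
have -> : dd (dz R iy) (dd (du R) (phi v)) m = dd (dz R iy) (phi v) m.
  have H z : 0 < z -> dd (du R) (phi v) (pt x z t 1) = phi v (pt x z t 1).
    by move=> z0; rewrite Du_phi.
  exact: is_derive_unique_pos y0 H (is_derive_pty (d2 _ _ Cp dm))
    (is_derive_pty (d1 _ Cp dm)).
have -> : dd (du R) (dd (dz R iy) (phi v)) m = dd (dz R iy) (phi v) m.
  have H u : dd (dz R iy) (phi v) (pt x y t u) = dd (dz R iy) (phi v) m * u.
    have E z : 0 < z -> phi v (pt x z t u) = u * phi v (pt x z t 1).
      by move=> z0; rewrite phi_lin.
    rewrite mulrC; apply: (is_derive_unique_pos y0 E).
      exact: is_derive_pty (d1 _ Cp (pt_dom t u x0 y0)).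
    exact: is_derive_cstl (is_derive_pty (d1 _ Cp dm)).
  apply: is_derive_unique (is_derive_ptu (d2 _ _ Cp dm)) _.
  rewrite (_ : (fun u => _) = fun u => dd (dz R iy) (phi v) m * u); last first.
    exact/funext.
  by apply: is_derive_eval (is_derive_cstl _ (is_derive_idfun 1)) _; rewrite mulr1.
by ring.
Qed.

Let xi_u k x y t u : 0 < x -> 0 < y -> xi v k (pt x y t u) = xi v k (pt x y t 1).
Proof.
move=> x0 y0; have dm u' := pt_dom t u' x0 y0.
apply: (is_derive_0_is_cst (f := fun u => xi v k (pt x y t u))) => u'.
apply: is_derive_eval (is_derive_ptu (d1 (du R) (Cx k) (dm u'))) _.
have [_ _ H [H1 H2 _]] := symmetry_first_order (dm u').
case: k => [[|[|[|//]]]] k3.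
- by rewrite (_ : Ordinal k3 = ix) //; exact/val_inj.
- by rewrite (_ : Ordinal k3 = iy) //; exact/val_inj.
- by rewrite (_ : Ordinal k3 = it) //; exact/val_inj.
Qed.

(** T_x and T_y vanish, so the value is constant along the path that moves x to 1 and then y to
    1. *)
Let tau_xy x y t : 0 < x -> 0 < y -> xi v it (pt x y t 1) = xi v it (pt 1 1 t 1).
Proof.
move=> x0 y0; transitivity (xi v it (pt 1 y t 1)).
  apply: (is_derive_0_is_cst_pos (f := fun x => xi v it (pt x y t 1))) => // z z0.
  have dm := pt_dom t 1 z0 y0; have [<- _ _ _] := symmetry_first_order dm.
  exact: is_derive_ptx (d1 _ (Cx it) dm).
apply: (is_derive_0_is_cst_pos (f := fun y => xi v it (pt 1 y t 1))) => // z z0.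
have dm := pt_dom t 1 ltr01 z0; have [_ <- _ _] := symmetry_first_order dm.
exact: is_derive_pty (d1 _ (Cx it) dm).
Qed.

Let tau_t x y t : 0 < x -> 0 < y ->
  dd (dz R it) (xi v it) (pt x y t 1) = dd (dz R it) (xi v it) (pt 1 1 t 1).
Proof.
move=> x0 y0.
apply: is_derive_unique (is_derive_ptt (d1 _ (Cx it) (pt_dom t 1 x0 y0))) _.
rewrite (_ : (fun t => _) = fun t => xi v it (pt 1 1 t 1)); last first.
  by apply/funext => s; rewrite tau_xy.
exact: is_derive_ptt (d1 _ (Cx it) (pt_dom t 1 ltr01 ltr01)).
Qed.

(** All functions are restricted to the slice u = 1, where phi is lambda and [general_solution]
    applies. The slice determines the field: [xi_u] and [phi_lin] restore the dependence on u. *)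
Lemma linear_symmetry_gsym : exists c, v = gsym c.
Proof.
pose F (f : base R -> R) x y t := f (pt x y t 1).
pose D k (f : base R -> R) := dd (dz R k) f.
pose X := xi v ix; pose Y := xi v iy; pose f := phi v; pose T := xi v it.
have dm x y t : 0 < x -> 0 < y -> dom R (pt x y t 1) by exact: pt_dom.
have px x y t : (pt x y t 1).1 0 ix = x by rewrite mxE.
have py x y t : (pt x y t 1).1 0 iy = y by rewrite mxE.
have p1x g : Cn (dom R) 2 g -> forall x y t : R, 0 < x -> 0 < y ->
    is_derive x 1 (fun x => F g x y t) (F (D ix g) x y t).
  by move=> Cg x y t x0 y0; apply: is_derive_ptx; apply: d1 Cg (dm _ _ _ x0 y0).
have p1y g : Cn (dom R) 2 g -> forall x y t : R, 0 < x -> 0 < y ->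
    is_derive y 1 (fun y => F g x y t) (F (D iy g) x y t).
  by move=> Cg x y t x0 y0; apply: is_derive_pty; apply: d1 Cg (dm _ _ _ x0 y0).
have p1t g : Cn (dom R) 2 g -> forall x y t : R, 0 < x -> 0 < y ->
    is_derive t 1 (fun t => F g x y t) (F (D it g) x y t).
  by move=> Cg x y t x0 y0; apply: is_derive_ptt; apply: d1 Cg (dm _ _ _ x0 y0).
have p2x g k : Cn (dom R) 2 g -> forall x y t : R, 0 < x -> 0 < y ->
    is_derive x 1 (fun x => F (D k g) x y t) (F (D ix (D k g)) x y t).
  by move=> Cg x y t x0 y0; apply: is_derive_ptx; apply: d2 Cg (dm _ _ _ x0 y0).
have p2y g k : Cn (dom R) 2 g -> forall x y t : R, 0 < x -> 0 < y ->
    is_derive y 1 (fun y => F (D k g) x y t) (F (D iy (D k g)) x y t).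
  by move=> Cg x y t x0 y0; apply: is_derive_pty; apply: d2 Cg (dm _ _ _ x0 y0).
have p2t g k : Cn (dom R) 2 g -> forall x y t : R, 0 < x -> 0 < y ->
    is_derive t 1 (fun t => F (D k g) x y t) (F (D it (D k g)) x y t).
  by move=> Cg x y t x0 y0; apply: is_derive_ptt; apply: d2 Cg (dm _ _ _ x0 y0).
have CX : Cn (dom R) 2 X := Cx ix; have CY : Cn (dom R) 2 Y := Cx iy.
have CT : Cn (dom R) 2 T := Cx it; have Cf : Cn (dom R) 2 f := Cp.
have e0 (x y t : R) : 0 < x -> 0 < y ->
    x * F (D ix Y) x y t + y * F (D iy X) x y t = 0.
  move=> x0 y0; have [_ _ _ [_ _ H]] := symmetry_first_order (dm x y t x0 y0).
  by rewrite px py in H; exact: H.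
have e2 (x y t : R) (x0 : 0 < x) (y0 : 0 < y) :=
  symmetry_second_order (dm x y t x0 y0).
have [c1 [c2 [c3 [c4 [c5 [c6 [c7 [c8 [c9 [ET EXY]]]]]]]]]] :=
  @general_solution R (F X) (F Y) (F f) _ _ _ _ _ _ _ _ _ _ _ _ _ _ _ (F T 1 1)
  (F (D it T) 1 1) (F (D it (D it T)) 1 1) (F (D it (D ix Y)) 1 1)
  (p1x _ CX) (p1y _ CX) (p1t _ CX) (p2x _ ix CX) (p2y _ iy CX)
  (p1x _ CY) (p1y _ CY) (p1t _ CY) (p2x _ ix CY) (p2y _ iy CY)
  (p1x _ Cf) (p1y _ Cf) (p1t _ Cf) (p2x _ ix Cf) (p2y _ iy Cf)
  (fun t => p1t _ CT _ _ t ltr01 ltr01) (fun t => p2t _ it CT _ _ t ltr01 ltr01)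
  (fun t => p2t _ ix CY _ _ t ltr01 ltr01) e0
  ltac:(move=> x y t x0 y0; have [H _ _ _ _] := e2 x y t x0 y0;
    rewrite px tau_t // in H; exact: H)
  ltac:(move=> x y t x0 y0; have [_ H _ _ _] := e2 x y t x0 y0;
    rewrite py tau_t // in H; exact: H)
  ltac:(move=> x y t x0 y0; have [_ _ H _ _] := e2 x y t x0 y0;
    rewrite px py tau_t // DDx_phi // in H; exact: H)
  ltac:(move=> x y t x0 y0; have [_ _ _ H _] := e2 x y t x0 y0;
    rewrite px py tau_t // DDy_phi // in H; exact: H)
  ltac:(move=> x y t x0 y0; have [_ _ _ _ H] := e2 x y t x0 y0;
    rewrite px py in H; exact: H).
pose c (i : 'I_9) : R := nth 0 [:: c1; c2; c3; c4; c5; c6; c7; c8; c9] i.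
exists c.
apply/funext => m; have := dom_val m; move=> [].
set x : R := (val m).1 0 ix; set y : R := (val m).1 0 iy => x0 y0.
pose t : R := (val m).1 0 it.
have vE : v m = 'valL_0 v (pt x y t (val m).2).
  rewrite -valL_val; congr ('valL_0 v _).
  by apply: base_eqP; rewrite /= ?mxE.
have [hx hy ht hu] := gsym_val c m.
have [EX EY EL] := EXY x y t x0 y0.
have sx := sqr_sqrtr (ltW x0); have sy := sqr_sqrtr (ltW y0).
apply: base_eqP; rewrite ?hx ?hy ?ht ?hu vE.
- rewrite -[LHS]/(xi v ix _) xi_u // -[LHS]/(F X x y t) EX /= /c /= -/x -/y -/t.
  by rewrite -expr2 sx; ring.
- rewrite -[LHS]/(xi v iy _) xi_u // -[LHS]/(F Y x y t) EY /= /c /= -/x -/y -/t.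
  by rewrite -expr2 sy; ring.
- rewrite -[LHS]/(xi v it _) xi_u // tau_xy // -[LHS]/(F T 1 1 t) ET /= /c /= -/t.
  by ring.
- rewrite -[LHS]/(phi v _) phi_lin // -[phi v _]/(F f x y t) EL /= /c /= -/x -/y -/t.
  by rewrite -!expr2 sx sy; ring.
Qed.

End OneSymmetry.
End Classification.

(** * The bracket in coordinates *)

Section StructureConstants.
Variable R : realType.
Implicit Types (c d : 'I_9 -> R) (m w : base R).

(** Entry [i] collects the coefficients of v_(i+1) in the brackets of the generators. For instance
    [P 0 2] occurs in entries 1 and 8 because [v_1, v_3] = - 2 v_2 + v_9. *)
Definition gbr c d (i : 'I_9) : R :=
  let P (k l : 'I_9) := c k * d l - c l * d k in
  nth 0 [:: - P 0 1; - 2 * P 0 2; - P 1 2; 0;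
    - P 0 5 + P 1 4 / 2 - P 3 6 / 2;
    - P 1 5 / 2 + P 2 4 - P 3 7 / 2;
    - P 0 7 + P 1 6 / 2 + P 3 4 / 2;
    - P 1 7 / 2 + P 2 6 + P 3 5 / 2;
    P 0 2 - P 4 5 - P 6 7] i.

Lemma derive_gsym c w m : dom R m ->
  [/\ ('D_w ('valL_0 (gsym c)) m).1 0 ix = ev (ed w (eX c)) m,
    ('D_w ('valL_0 (gsym c)) m).1 0 iy = ev (ed w (eY c)) m,
    ('D_w ('valL_0 (gsym c)) m).1 0 it = ev (ed w (eT c)) m
  & ('D_w ('valL_0 (gsym c)) m).2 = ev (ed w (eL c)) m].
Proof.
move=> dm; have dv := Cn_derivable w (smooth_gsym c 1) dm.
have E k : ('D_w ('valL_0 (gsym c)) m).1 0 k = ev (ed w (eV c k)) m.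
  have [_ H] := is_derive_clinear_comp (clinear_base R k) dv.
  rewrite -[LHS]H -dd_ev //; apply: dd_ext dm => z dz; exact: xi_gsym.
split; [exact: (E ix)|exact: (E iy)|exact: (E it)|].
have [_ H] := is_derive_clinear_comp (@clinear_snd R _ _) dv.
rewrite -[LHS]H -dd_ev //; apply: dd_ext dm => z dz; exact: phi_gsym.
Qed.

Lemma vf_br_gsym c d : vf_br (gsym c) (gsym d) = gsym (gbr c d).
Proof.
apply/funext => m; have dm := dom_val m; rewrite /vf_br.
have [cx cy ct cu] := gsym_val c m; have [dx dy dt du] := gsym_val d m.
have [bx by' bt bu] := gsym_val (gbr c d) m.
have [ex ey et eu] := derive_gsym d (gsym c m) dm.
have [fx fy ft fu] := derive_gsym c (gsym d m) dm.
have [x0 y0] := dm.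
have nx := sqrt_gt0_neq0 x0; have ny := sqrt_gt0_neq0 y0.
move: ('D_(gsym c m) _ _) ex ey et eu => e ex ey et eu.
move: ('D_(gsym d m) _ _) fx fy ft fu => f fx fy ft fu.
move: (gsym (gbr c d) m) bx by' bt bu => b bx by' bt bu.
move: (gsym c m) cx cy ct cu ex ey et eu => p cx cy ct cu ex ey et eu.
move: (gsym d m) dx dy dt du fx fy ft fu => q dx dy dt du fx fy ft fu.
apply: base_eqP.
- rewrite [LHS]/= !mxE ex fx bx /= ?cx ?cy ?ct ?cu ?dx ?dy ?dt ?du /= /gbr /=.
  move: (Num.sqrt _) (Num.sqrt _) nx ny (_ _ it) => s r nx ny t.
  move: (c 0) (c 1) (c 2) (c 3) (c 4) (c 5) (c 6) (c 7) (c 8).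
  move: (d 0) (d 1) (d 2) (d 3) (d 4) (d 5) (d 6) (d 7) (d 8).
  move=> d0 d1 d2 d3 d4 d5 d6 d7 d8 c0 c1 c2 c3 c4 c5 c6 c7 c8.
  by field; rewrite nx ny.
- rewrite [LHS]/= !mxE ey fy by' /= ?cx ?cy ?ct ?cu ?dx ?dy ?dt ?du /= /gbr /=.
  move: (Num.sqrt _) (Num.sqrt _) nx ny (_ _ it) => s r nx ny t.
  move: (c 0) (c 1) (c 2) (c 3) (c 4) (c 5) (c 6) (c 7) (c 8).
  move: (d 0) (d 1) (d 2) (d 3) (d 4) (d 5) (d 6) (d 7) (d 8).
  move=> d0 d1 d2 d3 d4 d5 d6 d7 d8 c0 c1 c2 c3 c4 c5 c6 c7 c8.
  by field; rewrite nx ny.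
- rewrite [LHS]/= !mxE et ft bt /= ?cx ?cy ?ct ?cu ?dx ?dy ?dt ?du /= /gbr /=.
  move: (_ _ it) => t.
  move: (c 0) (c 1) (c 2) (c 3) (c 4) (c 5) (c 6) (c 7) (c 8).
  move: (d 0) (d 1) (d 2) (d 3) (d 4) (d 5) (d 6) (d 7) (d 8).
  move=> d0 d1 d2 d3 d4 d5 d6 d7 d8 c0 c1 c2 c3 c4 c5 c6 c7 c8.
  by field.
- rewrite [LHS]/= eu fu bu /= ?cx ?cy ?ct ?cu ?dx ?dy ?dt ?du /= /gbr /=.
  move: (Num.sqrt _) (Num.sqrt _) nx ny (_ _ it) (_.2) => s r nx ny t u.
  move: (c 0) (c 1) (c 2) (c 3) (c 4) (c 5) (c 6) (c 7) (c 8).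
  move: (d 0) (d 1) (d 2) (d 3) (d 4) (d 5) (d 6) (d 7) (d 8).
  move=> d0 d1 d2 d3 d4 d5 d6 d7 d8 c0 c1 c2 c3 c4 c5 c6 c7 c8.
  by field; rewrite nx ny.
Qed.

Lemma gsym_lin (a : R) c d : gsym (fun i => a * c i + d i) = a *: gsym c + gsym d.
Proof.
rewrite /gsym scaler_sumr -big_split; apply: eq_bigr => i _ /=.
by rewrite scalerDl scalerA.
Qed.

Lemma gsym0 : gsym (fun=> 0) = 0 :> vfield R.
Proof. by rewrite /gsym big1 // => i _; rewrite scale0r. Qed.

Lemma forall_ord9 (P : 'I_9 -> Prop) : P 0 -> P 1 -> P 2 -> P 3 -> P 4 -> P 5 ->
  P 6 -> P 7 -> P 8 -> forall i, P i.
Proof.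
move=> P0 P1 P2 P3 P4 P5 P6 P7 P8 [[|[|[|[|[|[|[|[|[|//]]]]]]]]] i9];
  [move: P0|move: P1|move: P2|move: P3|move: P4|move: P5|move: P6|move: P7|move: P8];
  congr P; exact/val_inj.
Qed.

Lemma gsym_eq0 c : gsym c = 0 -> c = fun=> 0.
Proof.
move=> c0.
have H (y t : R) : 0 < y ->
    [/\ ev (eX c) (pt 1 (y ^+ 2) t 1) = 0, ev (eY c) (pt 1 (y ^+ 2) t 1) = 0,
    ev (eT c) (pt 1 (y ^+ 2) t 1) = 0 & ev (eL c) (pt 1 (y ^+ 2) t 1) = 0].
  move=> y0; have dm : dom R (pt 1 (y ^+ 2) t 1) by apply: pt_dom; rewrite ?exprn_gt0.
  pose m : dom R := exist _ (pt 1 (y ^+ 2) t 1) (mem_set dm).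
  have [] := gsym_val c m; rewrite c0 !mxE => H1 H2 H3 H4.
  by split; apply/esym; [exact: H1|exact: H2|exact: H3|exact: H4].
(* The argument [y] of [H] is the root of the second coordinate. T at t = 0, 1, -1 gives c_0, c_1,
   c_2; X at sqrt y = 1, 2 gives c_3 and c_5; the values at t = 0, 1 give the other constants. *)
have [X1 Y1 T1 L1] := H 1 0 ltr01.
have [X2 Y2 T2 L2] := H 1 1 ltr01.
have [_ _ T3 _] := H 1 (-1) ltr01.
have [X4 _ _ _] := H 2 0 (ltr0Sn _ _).
move: X1 Y1 T1 L1 X2 Y2 T2 L2 T3 X4.
rewrite /= !mxE /= !sqrtr_sqr !sqrtr1 normr1 ger0_norm //.
move=> X1 Y1 T1 L1 X2 Y2 T2 L2 T3 X4.
apply/funext; apply: forall_ord9; lra.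
Qed.

Lemma gsym_inj : injective (@gsym R).
Proof.
move=> c d cd; have : gsym (fun i => -1 * d i + c i) = 0.
  by rewrite gsym_lin cd scaleN1r addNr.
move=> /gsym_eq0 /(congr1 (fun f => f _)) H; apply/funext => i.
by have := H i; lra.
Qed.

(** Symmetries are exactly the fields [gsym c], on which [vf_br] acts as [gbr]; bilinearity,
    alternation and the Jacobi identity become polynomial identities in the coordinates. *)
Lemma lie_on_linear_symmetries :
  lie_on (@vf_br R (base R) (dom R)) (linear_symmetries (1 / 4) 0 (1 / 4) 0).
Proof.
have S v : linear_symmetries (1 / 4) 0 (1 / 4) 0 v <-> exists c, v = gsym c.
  split; first exact: linear_symmetry_gsym.
  by move=> [c ->]; exact: linear_symmetries_gsym.
have D c d : gsym c + gsym d = gsym (fun i => c i + d i).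
  by rewrite -[gsym c]scale1r -gsym_lin; congr gsym; apply/funext => i; rewrite mul1r.
split=> [|a x y /S[c ->] /S[d ->]|x y /S[c ->] /S[d ->]
  |a x y z /S[c ->] /S[d ->] /S[e ->]|a x y z /S[c ->] /S[d ->] /S[e ->]|x /S[c ->]
  |x y z /S[c ->] /S[d ->] /S[e ->]].
- by apply/S; exists (fun=> 0); rewrite gsym0.
- by apply/S; exists (fun i => a * c i + d i); rewrite gsym_lin.
- by apply/S; exists (gbr c d); rewrite vf_br_gsym.
- rewrite -gsym_lin !vf_br_gsym -gsym_lin; congr gsym.
  by apply/funext; apply: forall_ord9; rewrite /gbr /=; ring.
- rewrite -gsym_lin !vf_br_gsym -gsym_lin; congr gsym.
  by apply/funext; apply: forall_ord9; rewrite /gbr /=; ring.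
- rewrite vf_br_gsym -gsym0; congr gsym.
  by apply/funext; apply: forall_ord9; rewrite /gbr /=; ring.
- rewrite !vf_br_gsym !D -gsym0; congr gsym.
  by apply/funext; apply: forall_ord9; rewrite /gbr /=; field.
Qed.

End StructureConstants.

(** * Quotients by kernels and split extensions of Lie algebras *)

Lemma val_lieSub_sum (R : pzRingType) (A : lmodType R) (br : A -> A -> A)
    (S : set A) (hS : lie_on br S) n (c : 'I_n -> R) (b : 'I_n -> lieSub hS) :
  val (\sum_i c i *: b i) = \sum_i c i *: val (b i).
Proof.
by rewrite (big_morph (val : lieSub hS -> A) (id1 := 0) (op1 := +%R)).
Qed.

Lemma lbr_derivation (R : pzRingType) (g : lieAlgType R) (x u w : g) :
  lbr x (lbr u w) = lbr (lbr x u) w + lbr u (lbr x w).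
Proof.
rewrite (lbrC (lbr x u)) (lbrC x w) lbrNr; apply/eqP; rewrite -subr_eq0.
by rewrite -opprD opprK [X in _ + X]addrC addrA; apply/eqP/lbr_jacobi.
Qed.

Section SplitExtension.
Variables (R : pzRingType) (g h : lieAlgType R) (J : set g) (hJ : lie_ideal J).
Variable F : g -> h.
Hypotheses (Flin : linear F) (Fbr : {morph F : x y / lbr x y >-> lbr x y})
  (FJ : forall x, F x = 0 <-> J x).

Let FB x y : F (x - y) = F x - F y.
Proof. by have := Flin (-1) y x; rewrite !scaleN1r (addrC (- y)) (addrC (- F y)). Qed.

(** The first isomorphism theorem: [F] has kernel [J], and the inverse of the induced map sends y to
    the class of [s y]. *)
Lemma lieQuot_iso (s : h -> g) : cancel s F ->
  exists f : lieQuot hJ -> h, lie_iso f /\ forall x, f (lie_pi hJ x) = F x.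
Proof.
move=> sK.
pose rep (q : lieQuot hJ) : g := repr (q : {eq_quot coset_equiv hJ}).
have repK q : lie_pi hJ (rep q) = q by exact: reprK.
pose f q := F (rep q).
have fpi x : f (lie_pi hJ x) = F x.
  by apply/subr0_eq; rewrite -FB; apply/FJ/(lie_piP hJ); rewrite repK.
exists f; split=> //; split.
- by move=> a p q; rewrite -[p]repK -[q]repK -lie_piZ -lie_piD !fpi Flin.
- exists (fun y => lie_pi hJ (s y)) => [q|y]; last by rewrite fpi sK.
  by rewrite -[RHS]repK; apply/(lie_piP hJ)/FJ; rewrite FB sK subrr.
- move=> p q; rewrite -[p]repK -[q]repK [RHS](congr2 _ (fpi _) (fpi _)) -Fbr -fpi.
  exact: (congr1 f (quot_brE hJ (rep p) (rep q))).
Qed.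

(** [h] acts on the ideal through the adjoint action of [s x]. The isomorphism is (x, j) -> s x + j,
    with inverse x -> (F x, x - s (F x)). *)
Lemma semidirect_iso (s : h -> g) :
  linear s -> {morph s : x y / lbr x y >-> lbr x y} -> cancel s F ->
  exists (rho : h -> lieIdeal hJ -> lieIdeal hJ) (hrho : lie_action rho)
    (f : semidirect hrho -> g),
    lie_iso f /\ forall j : lieIdeal hJ, f (0, j) = sval j.
Proof.
move=> slin sbr sK.
have s0 : s 0 = 0 by have := slin (-1) 0 0; rewrite scaler0 addr0 scaleN1r addNr.
pose rho x (j : lieIdeal hJ) : lieIdeal hJ :=
  exist _ (lbr (s x) (sval j)) (mem_set (lie_ideal_br hJ (s x) (lieSubP j))).
have hrho : lie_action rho.
  split=> [x a u w|a x y u|x u w|x y u]; apply/val_inj.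
  - exact: lbr_linearr.
  - by rewrite /= slin; exact: lbr_linearl.
  - exact: lbr_derivation.
  - by rewrite /= sbr lbr_derivation addrK.
exists rho, hrho.
pose f (p : semidirect hrho) : g := s p.1 + sval p.2.
exists f; split; last by move=> j; rewrite /f /= s0 add0r.
have Jg x : x - s (F x) \in J.
  by apply/mem_set/FJ; rewrite FB sK subrr.
split.
- move=> a [x u] [y w]; rewrite /f /= slin scalerDr addrACA; congr (_ + _).
- exists (fun x => (F x, exist _ (x - s (F x)) (Jg x)) : semidirect hrho).
    move=> [x [u Ju]]; rewrite /f /=.
    have Fu : F u = 0 by apply/FJ/set_mem.
    have E : F (s x + u) = x.
      by have := Flin 1 (s x) u; rewrite !scale1r Fu addr0 sK.
    congr pair; first exact: E.
    by apply/val_inj; rewrite /= E addrC addKr.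
  by move=> x; rewrite /f /= addrC subrK.
- move=> [x u] [y w]; rewrite /f /= sbr /= !lbrDl !lbrDr -!addrA; congr (_ + _).
  rewrite (lbrC (sval u) (s y)).
  by rewrite addrC -!addrA; congr (_ + _); rewrite addrC addrA.
Qed.

End SplitExtension.

(** * The symmetry algebra, its ideal and its projection to sl_2 *)

Section LieAlgebraStructure.
Variable R : realType.

Definition symAlg : lieAlgType R := lieSub (lie_on_linear_symmetries R).
Local Notation L := symAlg.
Implicit Types (x y : L) (c : 'I_9 -> R).

Definition of_coords c : L := exist _ (gsym c) (mem_set (linear_symmetries_gsym c)).

(** The coordinates are obtained by choice; [gsym_inj] makes them unique. *)
Definition coords x : 'I_9 -> R := sval (cid (linear_symmetry_gsym (lieSubP x))).

Lemma coordsK : cancel coords of_coords.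
Proof.
move=> x; apply/val_inj; apply: esym.
exact: (svalP (cid (linear_symmetry_gsym (lieSubP x)))).
Qed.

Lemma of_coordsK : cancel of_coords coords.
Proof. by move=> c; apply: gsym_inj; exact: (congr1 val (coordsK (of_coords c))). Qed.

Lemma of_coords_lin (a : R) c d :
  of_coords (fun i => a * c i + d i) = a *: of_coords c + of_coords d.
Proof. by apply/val_inj; exact: gsym_lin. Qed.

Lemma of_coords_br c d : lbr (of_coords c) (of_coords d) = of_coords (gbr c d).
Proof. by apply/val_inj; exact: vf_br_gsym. Qed.

Lemma coords_lin (a : R) x y i : coords (a *: x + y) i = a * coords x i + coords y i.
Proof.
by rewrite -{1}[x]coordsK -{1}[y]coordsK -of_coords_lin of_coordsK.
Qed.

Lemma coords_br x y : coords (lbr x y) = gbr (coords x) (coords y).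
Proof. by rewrite -{1}[x]coordsK -{1}[y]coordsK of_coords_br of_coordsK. Qed.

Lemma coords0 i : coords 0 i = 0.
Proof. by have := coords_lin (-1) 0 0 i; rewrite scaler0 addr0; lra. Qed.

Lemma gsym_delta i : gsym (fun j => (i == j)%:R) = @vsym R i.
Proof.
rewrite /gsym (bigD1 i) //= eqxx scale1r big1 ?addr0 // => j /negPf ji.
by rewrite eq_sym ji scale0r.
Qed.

Definition symBasis (i : 'I_9) : L := of_coords (fun j => (i == j)%:R).

Lemma sum_symBasis c : \sum_i c i *: symBasis i = of_coords c.
Proof.
apply/val_inj; rewrite [RHS]/= /gsym.
rewrite val_lieSub_sum.
by apply: eq_bigr => i _; congr (_ *: _); exact: gsym_delta.
Qed.

Lemma is_basis_symBasis : is_basis symBasis.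
Proof.
split=> [c|]; last first.
  apply/seteqP; split=> // x _; exists (coords x).
  by rewrite sum_symBasis coordsK.
by rewrite sum_symBasis => c0 i; rewrite -[c]of_coordsK c0 coords0.
Qed.

Definition ideal6 : set L := lspan (fun i : 'I_6 => symBasis (rshift 3 i)).

Definition pad (c : 'I_6 -> R) (i : 'I_9) : R :=
  if fintype.split (i : 'I_(3 + 6)) is inr j then c j else 0.

Lemma sum_symBasis6 (c : 'I_6 -> R) :
  \sum_i c i *: symBasis (rshift 3 i) = of_coords (pad c).
Proof.
rewrite -sum_symBasis [RHS](@big_split_ord _ _ _ 3 6) /= [X in _ = X + _]big1 ?add0r
    => [|i _].
  apply: eq_bigr => i _; congr (_ *: _).
  by rewrite /pad (unsplitK (inr i)).
by rewrite /pad (unsplitK (inl i)) scale0r.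
Qed.

Lemma ideal6P x : ideal6 x <-> [/\ coords x 0 = 0, coords x 1 = 0 & coords x 2 = 0].
Proof.
split=> [[c ->]|[x0 x1 x2]].
  by rewrite sum_symBasis6 of_coordsK; split; rewrite /pad /fintype.split; case: ltnP.
exists (fun i => coords x (rshift 3 i)); rewrite sum_symBasis6.
rewrite -[LHS]coordsK; congr of_coords.
apply/funext => i; rewrite /pad -[i in LHS](splitK (i : 'I_(3 + 6))).
case: (fintype.split _) => j //=; case: j => [[|[|[|//]]]] j3 /=.
- by rewrite -[RHS]x0; congr (coords x); exact/val_inj.
- by rewrite -[RHS]x1; congr (coords x); exact/val_inj.
- by rewrite -[RHS]x2; congr (coords x); exact/val_inj.
Qed.

(** The first three entries of [gbr] involve only minors in the first three coordinates, which
    vanish when one argument has these coordinates zero. *)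
Lemma lie_ideal6 : lie_ideal ideal6.
Proof.
split=> [|a x y /ideal6P[x0 x1 x2] /ideal6P[y0 y1 y2]|x y /ideal6P[y0 y1 y2]].
- by apply/ideal6P; rewrite !coords0.
- by apply/ideal6P; rewrite !coords_lin x0 x1 x2 y0 y1 y2 !mulr0 !addr0.
- by apply/ideal6P; rewrite !coords_br /gbr /= y0 y1 y2; split; ring.
Qed.

Lemma has_dim_ideal6 : has_dim 6 (lieIdeal lie_ideal6).
Proof.
have bJ i : ideal6 (symBasis (rshift 3 i)).
  by apply/ideal6P; rewrite of_coordsK; split; rewrite -val_eqE.
pose b i : lieIdeal lie_ideal6 := exist _ (symBasis (rshift 3 i)) (mem_set (bJ i)).
have vb (c : 'I_6 -> R) : val (\sum_i c i *: b i) = \sum_i c i *: symBasis (rshift 3 i).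
  exact: val_lieSub_sum.
exists b; split=> [c c0 i|]; last first.
  apply/seteqP; split=> // j _; have [c cE] := lieSubP j.
  by exists c; apply/val_inj; rewrite vb.
have := vb c; rewrite c0 sum_symBasis6 => /(congr1 (fun x => coords x (rshift 3 i))).
by rewrite of_coordsK /pad (unsplitK (inr i)) coords0.
Qed.

Definition sl2mx (a b c : R) : 'M[R]_2 :=
  a *: delta_mx 0 1 + b *: (delta_mx 0 0 - delta_mx 1 1) - c *: delta_mx 1 0.

Lemma tr_sl2mx (a b c : R) : \tr (sl2mx a b c) = 0.
Proof. by rewrite /mxtrace !big_ord_recl big_ord0 !mxE /=; ring. Qed.

(** The half reflects v_2 -> H/2; the sign in v_3 -> - F is built into [sl2mx]. *)
Definition toSl2 x : sl2 R :=
  exist _ (sl2mx (coords x 0) (coords x 1 / 2) (coords x 2)) (mem_set (tr_sl2mx _ _ _)).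

(* [v_1, v_3] = - 2 v_2 + v_9, so that H must go to 2 v_2 - v_9, not to 2 v_2. *)
Definition ofSl2 (A : sl2 R) : L :=
  of_coords (fun i => nth 0 [:: val A 0 1; 2 * val A 0 0; - val A 1 0;
                        0; 0; 0; 0; 0; - val A 0 0] i).

Lemma matrix2P (A B : 'M[R]_2) : A 0 0 = B 0 0 -> A 0 1 = B 0 1 -> A 1 0 = B 1 0 ->
  A 1 1 = B 1 1 -> A = B.
Proof.
move=> h00 h01 h10 h11; apply/matrixP => i j.
have E (k : 'I_2) : k = 0 \/ k = 1.
  by case: k => [[|[|//]]] k2; [left|right]; exact/val_inj.
by case: (E i) => ->; case: (E j) => ->.
Qed.

Lemma sl2_tr (A : sl2 R) : val A 1 1 = - val A 0 0.
Proof.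
have : \tr (val A) = 0 by exact: lieSubP A.
rewrite /mxtrace !big_ord_recl big_ord0 addr0 (_ : lift ord0 ord0 = 1).
  by move=> /eqP; rewrite addrC addr_eq0 => /eqP.
exact/val_inj.
Qed.

Lemma mx_comm2E (A B : 'M[R]_2) i j : mx_comm A B i j =
  A i 0 * B 0 j + A i 1 * B 1 j - (B i 0 * A 0 j + B i 1 * A 1 j).
Proof.
have E (C D : 'M[R]_2) : (C *m D) i j = C i 0 * D 0 j + C i 1 * D 1 j.
  rewrite mxE !big_ord_recl big_ord0 addr0.
  by congr (_ * _ + C _ _ * D _ _); exact/val_inj.
by rewrite -!E !mxE.
Qed.

Lemma toSl2_linear : linear toSl2.
Proof.
move=> a x y; apply/val_inj; rewrite /= !coords_lin.
by apply: matrix2P; rewrite !mxE /=; field.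
Qed.

(** The first three entries of [gbr] are the structure constants of sl_2 in the basis E, H/2, -
    F. *)
Lemma toSl2_br : {morph toSl2 : x y / lbr x y >-> lbr x y}.
Proof.
move=> x y; apply/val_inj; rewrite [LHS]/= [RHS]/= !coords_br.
by apply: matrix2P; rewrite mx_comm2E !mxE /gbr /=; field.
Qed.

Lemma toSl2_eq0 x : toSl2 x = 0 <-> ideal6 x.
Proof.
split=> [/(congr1 val) /= E|/ideal6P[x0 x1 x2]].
  have H i j := congr1 (fun A : 'M[R]_2 => A i j) E.
  have := H 0 1; have := H 0 0; have := H 1 0; rewrite !mxE /= => h1 h2 h3.
  by apply/ideal6P; split; lra.
by apply/val_inj; apply: matrix2P; rewrite /= x0 x1 x2 !mxE /=; field.
Qed.

Lemma ofSl2K : cancel ofSl2 toSl2.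
Proof.
move=> A; apply/val_inj; rewrite /= !of_coordsK /=.
by apply: matrix2P; rewrite ?sl2_tr !mxE /=; field.
Qed.

Lemma ofSl2_linear : linear ofSl2.
Proof.
move=> a A B; rewrite /ofSl2 -of_coords_lin; congr of_coords; apply/funext.
by apply: forall_ord9; rewrite /= ?mxE /=; ring.
Qed.

(** The ninth coordinate matches because [P 0 2] is minus the upper left entry of the commutator, as
    the last coordinate of [ofSl2] requires. *)
Lemma ofSl2_br : {morph ofSl2 : x y / lbr x y >-> lbr x y}.
Proof.
move=> A B; rewrite [RHS]of_coords_br; congr of_coords; apply/funext.
have EA := sl2_tr A; have EB := sl2_tr B.
by apply: forall_ord9; rewrite /gbr /= ?mx_comm2E ?EA ?EB; field.
Qed.

Lemma toSl2_symBasis : [/\ toSl2 (symBasis 0) = sl2E R,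
  toSl2 (symBasis 1) = (1 / 2) *: sl2H R & toSl2 (symBasis 2) = - sl2F R].
Proof.
by split; apply/val_inj; apply: matrix2P; rewrite /= !of_coordsK !mxE /=; field.
Qed.

End LieAlgebraStructure.

Theorem mainTheorem1 (R : realType) :
  exists (hL : lie_on (@vf_br R (base R) (dom R))
                 (linear_symmetries (1 / 4) 0 (1 / 4) 0)),
  let L : lieAlgType R := lieSub hL in
  has_dim 9 L /\
  exists w : 'I_9 -> L,
    (forall i, sval (w i) = @vsym R i) /\ is_basis w /\
    exists hJ : lie_ideal (lspan (fun i : 'I_6 => w (rshift 3 i))),
    let J : lieAlgType R := lieIdeal hJ in
    let LJ : lieAlgType R := lieQuot hJ in
    has_dim 6 J /\
    (exists f : LJ -> sl2 R,
        lie_iso f /\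
        f (lie_pi hJ (w 0)) = sl2E R /\
        f (lie_pi hJ (w 1)) = (1 / 2) *: sl2H R /\
        f (lie_pi hJ (w 2)) = - sl2F R) /\
    (exists (rho : sl2 R -> J -> J) (hrho : lie_action rho)
            (f : semidirect hrho -> L),
        lie_iso f /\ forall j : J, f (0, j) = sval j).
Proof.
exists (lie_on_linear_symmetries R); cbv zeta.
split; first by exists (@symBasis R); exact: is_basis_symBasis.
exists (@symBasis R); split; first exact: gsym_delta.
split; first exact: is_basis_symBasis.
exists (lie_ideal6 R); split; first exact: has_dim_ideal6.
split.
  have [f [fiso fE]] := lieQuot_iso (lie_ideal6 R) (@toSl2_linear R)
    (@toSl2_br R) (@toSl2_eq0 R) (@ofSl2K R).
  have [eE eH eF] := toSl2_symBasis R.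
  exists f; split; first exact: fiso.
  split; first by rewrite -eE; exact: fE.
  by split; [rewrite -eH; exact: fE|rewrite -eF; exact: fE].
(* The section [ofSl2] is itself a morphism of Lie algebras, so the extension of sl_2 by the ideal
   splits. *)
exact: (semidirect_iso (lie_ideal6 R) (@toSl2_linear R) (@toSl2_eq0 R)
  (@ofSl2_linear R) (@ofSl2_br R) (@ofSl2K R)).
Qed.
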